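(* Let $T$ be the heat-semigroup on the non-commutative torus $A^N_\theta$ (complex twists) and $S$ the heat-semigroup on $\mathbb R^N/2\pi\mathbb Z^N$. Then, for all $t\in\mathbb R_{>0}$, $T(t)$ is of trace class and $$\mathrm{Htr}_{A^N_\theta}(t)=\operatorname{tr}T(t)=\operatorname{tr}S(t).$$ In particular, the $k$-th heat coefficient $A_k(A^N_\theta)$ of $A^N_\theta$ coincides with the $k$-th heat coefficient $A_k(\mathbb R^N/2\pi\mathbb Z^N)$ of $\mathbb R^N/2\pi\mathbb Z^N$.
   Context: $N\in\mathbb N$; $\theta$ is a real anti-symmetric $N\times N$ matrix. $A^N_\theta$ is the C*-algebra generated by unitaries $U_k$ ($k\in\mathbb Z^N$) with $U_0=1$ and $U_mU_n=e^{-\pi i\langle m,\theta n\rangle_{\ell_2(N)}}U_{m+n}$, so that the twists are complex numbers. The Laplacian acts by $\Delta_\theta U_k=-\|k\|^2_{\ell_2(N)}U_k$ and the heat-semigroup by $T(t)U_k=e^{-t\|k\|^2_{\ell_2(N)}}U_k$. $S$ is the semigroup generated by the (non-positive) Laplacian on the flat torus $\mathbb R^N/2\pi\mathbb Z^N$. Traces on $A^N_\theta$ are spectral: an operator $U_k\mapsto\lambda_kU_k$ is of trace class if $(\lambda_k)_{k\in\mathbb Z^N}$ is absolutely summable, with trace $\sum_k\lambda_k$. $\mathrm{Htr}_{A^N_\theta}(t)$ denotes the heat-trace $\operatorname{tr}T(t)$. Heat coefficients $A_k$ are the coefficients in the asymptotic expansion, as $t\searrow0$, of the heat-trace in the form $(4\pi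 t)^{-N/2}\sum_{k\in\mathbb N_0}A_kt^{k/2}$. *)

(* Defs.v *)
From HB Require Import structures.
From mathcomp Require Import all_boot all_order all_algebra.
From mathcomp Require Import all_classical all_reals all_analysis.
From mathcomp Require Import complex.

Set Implicit Arguments.
Unset Strict Implicit.
Unset Printing Implicit Defensive.

Import Order.TTheory GRing.Theory Num.Theory.
Import numFieldNormedType.Exports.

Local Open Scope classical_set_scope.
Local Open Scope ring_scope.
Local Open Scope complex_scope.

Definition cis {R : realType} (x : R) : R[i] := cos x +i* sin x.

Definition cabs {R : realType} (z : R[i]) : R := complex.Re `|z|.

Definition abs_summable {R : realType} {I : choiceType} (D : set I)
  (f : I -> R[i]) : Prop := summable D (fun i => (cabs (f i))%:E).

Definition real_sum {R : realType} {I : choiceType} (D : set I) (f : I -> R) : R :=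
  fine (esum D (EFin \o f)^\+ - esum D (EFin \o f)^\-)%E.

(* Meaningful only when [abs_summable D f]. *)
Definition csum {R : realType} {I : choiceType} (D : set I) (f : I -> R[i]) : R[i] :=
  real_sum D (fun i => complex.Re (f i)) +i* real_sum D (fun i => complex.Im (f i)).

(* The values [S t] at t < 0 are irrelevant. *)
Definition C0_semigroup {R : realType} {X : normedModType R[i]}
    (S : R -> X -> X) : Prop :=
  [/\ forall t, 0 <= t -> linear (S t) /\ continuous (S t),
      forall x, S 0 x = x,
      forall s t x, 0 <= s -> 0 <= t -> S (s + t) x = S s (S t x) &
      forall x, S t x @[t --> 0^'+] --> x].

Definition generator {R : realType} {X : normedModType R[i]}
    (S : R -> X -> X) : set (X * X) :=
  [set xy | (h%:C)^-1 *: (S h xy.1 - xy.1) @[h --> 0^'+] --> xy.2].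

(* Nonzero unital C*-algebras.  The product is part of the mixin because the
   library has no join of its normed modules with its rings. *)

HB.mixin Record isCstar (R : realType) A & CompleteNormedModule R[i] A := {
  cone : A ;
  cmul : A -> A -> A ;
  cstar : A -> A ;
  cone_neq0 : cone != 0 ;
  cmulA : forall x y z : A, cmul x (cmul y z) = cmul (cmul x y) z ;
  cmul1l : forall x : A, cmul cone x = x ;
  cmul1r : forall x : A, cmul x cone = x ;
  cmul_linearl : forall (a : R[i]) (x y z : A),
    cmul (a *: x + y) z = a *: cmul x z + cmul y z ;
  cmul_linearr : forall (a : R[i]) (x y z : A),
    cmul z (a *: x + y) = a *: cmul z x + cmul z y ;
  cstarK : forall x : A, cstar (cstar x) = x ;
  cstar_antilinear : forall (a : R[i]) (x y : A),
    cstar (a *: x + y) = conjc a *: cstar x + cstar y ;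
  cstarM : forall x y : A, cstar (cmul x y) = cmul (cstar y) (cstar x) ;
  cnormM : forall x y : A, `|cmul x y| <= `|x| * `|y| ;
  cnorm_star : forall x : A, `|cmul (cstar x) x| = `|x| ^+ 2
}.

#[short(type="cstarAlgType")]
HB.structure Definition CstarAlgebra (R : realType) :=
  {A of CompleteNormedModule R[i] A & isCstar R A}.

(* <m, theta n> on row vectors. *)
Definition twist {R : realType} {N : nat} (theta : 'M[R]_N)
    (m n : 'rV[int]_N) : R :=
  (map_mx intr m *m theta *m (map_mx intr n)^T) 0 0.

Definition sqnorm {R : realType} {N : nat} (k : 'rV[int]_N) : R :=
  \sum_(i < N) (k 0 i)%:~R ^+ 2.

Definition torus_relations {R : realType} {N : nat} (theta : 'M[R]_N)
    {A : cstarAlgType R} (U : 'rV[int]_N -> A) : Prop :=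
  [/\ U 0 = cone,
      forall k, cmul (cstar (U k)) (U k) = cone,
      forall k, cmul (U k) (cstar (U k)) = cone &
      forall m n, cmul (U m) (U n) = cis (- (pi * twist theta m n)) *: U (m + n)].

Definition star_morphism {R : realType} {A B : cstarAlgType R}
    (phi : A -> B) : Prop :=
  [/\ linear phi, phi cone = cone,
      forall x y, phi (cmul x y) = cmul (phi x) (phi y) &
      forall x, phi (cstar x) = cstar (phi x)].

Definition closed_star_subalgebra {R : realType} {A : cstarAlgType R}
    (D : set A) : Prop :=
  [/\ closed D, D cone,
      forall (a : R[i]) x y, D x -> D y -> D (a *: x + y),
      forall x y, D x -> D y -> D (cmul x y) &
      forall x, D x -> D (cstar x)].

(* [A] is the (universal) C*-algebra generated by unitaries [U k] subject to
   the torus relations.  This determines the pair [(A, U)] up to a unique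
   *-isomorphism. *)
Definition is_nc_torus {R : realType} {N : nat} (theta : 'M[R]_N)
    (A : cstarAlgType R) (U : 'rV[int]_N -> A) : Prop :=
  [/\ torus_relations theta U,
      forall D : set A, closed_star_subalgebra D -> (forall k, D (U k)) ->
        D = setT &
      forall (B : cstarAlgType R) (V : 'rV[int]_N -> B),
        torus_relations theta V ->
        exists2 phi : A -> B, star_morphism phi & forall k, phi (U k) = V k].

Definition nc_heat_semigroup {R : realType} {N : nat} {A : cstarAlgType R}
    (U : 'rV[int]_N -> A) (T : R -> A -> A) : Prop :=
  C0_semigroup T /\
  forall t k, 0 <= t -> T t (U k) = (expR (- t * sqnorm k))%:C *: U k.

Definition nc_trace_class {R : realType} {N : nat} {A : cstarAlgType R}
    (U : 'rV[int]_N -> A) (B : A -> A) : Prop :=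
  exists2 lambda : 'rV[int]_N -> R[i],
    forall k, B (U k) = lambda k *: U k & abs_summable setT lambda.

Definition nc_trace {R : realType} {N : nat} {A : cstarAlgType R}
    (U : 'rV[int]_N -> A) (B : A -> A) : R[i] :=
  csum setT (fun k => xget 0 [set lambda | B (U k) = lambda *: U k]).

Definition nc_heat_trace {R : realType} {N : nat} {A : cstarAlgType R}
    (U : 'rV[int]_N -> A) (T : R -> A -> A) (t : R) : R[i] := nc_trace U (T t).

(* With [H] complete, this makes [H] a Hilbert space; linear on the left. *)
Definition inner_product {R : realType} (H : normedModType R[i])
    (ip : H -> H -> R[i]) : Prop :=
  [/\ forall (a : R[i]) x y z, ip (a *: x + y) z = a * ip x z + ip y z,
      forall x y, ip y x = conjc (ip x y) &
      forall x, ip x x = `|x| ^+ 2].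

(* A maximal orthonormal set. *)
Definition orthonormal_basis {R : realType} {H : normedModType R[i]}
    (ip : H -> H -> R[i]) (E : set H) : Prop :=
  (forall e f, E e -> E f -> ip e f = (e == f)%:R) /\
  (forall x, (forall e, E e -> ip x e = 0) -> x = 0).

(* [P] is |B|, the positive square root of B^* B: positive operators are
   self-adjoint, so that <P x, P y> = <P^2 x, y> and <B x, B y> = <B^* B x, y>. *)
Definition absolute_value {R : realType} {H : normedModType R[i]}
    (ip : H -> H -> R[i]) (B P : H -> H) : Prop :=
  [/\ linear P, continuous P, forall x, 0 <= ip (P x) x &
      forall x y, ip (P x) (P y) = ip (B x) (B y)].

(* tr |B| < oo; for a positive operator the choice of the basis is
   immaterial. *)
Definition trace_class {R : realType} {H : normedModType R[i]}
    (ip : H -> H -> R[i]) (B : H -> H) : Prop :=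
  [/\ linear B, continuous B &
      exists P E, [/\ absolute_value ip B P, orthonormal_basis ip E &
        abs_summable E (fun e => ip (P e) e)]].

(* The common value of the sums of <B e, e> over the orthonormal bases. *)
Definition trace {R : realType} {H : normedModType R[i]}
    (ip : H -> H -> R[i]) (B : H -> H) : R[i] :=
  xget 0 [set tau | forall E, orthonormal_basis ip E ->
    csum E (fun e => ip (B e) e) = tau].

(* The flat torus R^N / 2 pi Z^N: functions on it are the functions on R^N
   with period lattice 2 pi Z^N. *)

Definition periodic {R : realType} {N : nat} (f : 'rV[R]_N -> R[i]) : Prop :=
  forall x (k : 'rV[int]_N), f (x + (2 * pi) *: map_mx intr k) = f x.

Definition re_part {R : realType} {N : nat} (f : 'rV[R]_N -> R[i]) :
  'rV[R]_N -> R := fun x => complex.Re (f x).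

Definition im_part {R : realType} {N : nat} (f : 'rV[R]_N -> R[i]) :
  'rV[R]_N -> R := fun x => complex.Im (f x).

Definition partial {R : realType} {N : nat} (i : 'I_N) (g : 'rV[R]_N -> R) :
  'rV[R]_N -> R := fun x => 'D_(delta_mx 0 i) g x.

Fixpoint Ck {R : realType} {N : nat} (n : nat) (g : 'rV[R]_N -> R) : Prop :=
  continuous g /\
  if n is n'.+1 then
    (forall i x, derivable g x (delta_mx 0 i)) /\ forall i, Ck n' (partial i g)
  else True.

Definition torus_continuous {R : realType} {N : nat} :
    set ('rV[R]_N -> R[i]) :=
  [set f | [/\ periodic f, continuous (re_part f) & continuous (im_part f)]].

Definition torus_smooth {R : realType} {N : nat} : set ('rV[R]_N -> R[i]) :=
  [set f | periodic f /\ forall n, Ck n (re_part f) /\ Ck n (im_part f)].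

Definition laplacian {R : realType} {N : nat} (f : 'rV[R]_N -> R[i]) :
    'rV[R]_N -> R[i] :=
  fun x => (\sum_(i < N) partial i (partial i (re_part f)) x) +i*
           (\sum_(i < N) partial i (partial i (im_part f)) x).

(* Iterated integral over the fundamental domain [0, 2 pi]^N. *)
Fixpoint cube_integral {R : realType} (n : nat) : ('rV[R]_n -> R) -> R :=
  if n is n'.+1 then fun g : 'rV[R]_(1 + n') -> R =>
    \int[lebesgue_measure]_(x in `[0, 2 * pi])
      cube_integral (fun y : 'rV[R]_n' => g (row_mx (x%:M : 'rV[R]_1) y))
  else fun g => g 0.

Definition torus_integral {R : realType} {N : nat} (f : 'rV[R]_N -> R[i]) : R[i] :=
  cube_integral (re_part f) +i* cube_integral (im_part f).

(* The Hilbert space L^2(R^N / 2 pi Z^N), as the completion of the continuous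
   functions for the L^2 inner product: [iota f] is the class of [f].
   The value of [iota] outside [torus_continuous] is irrelevant. *)
Definition is_torus_L2 {R : realType} (N : nat) (H : completeNormedModType R[i])
    (ip : H -> H -> R[i]) (iota : ('rV[R]_N -> R[i]) -> H) : Prop :=
  [/\ inner_product ip,
      forall (a : R[i]) f g, torus_continuous f -> torus_continuous g ->
        iota (fun x => a * f x + g x) = a *: iota f + iota g,
      forall f g, torus_continuous f -> torus_continuous g ->
        ip (iota f) (iota g) = torus_integral (fun x => f x * conjc (g x)) &
      dense (iota @` torus_continuous)].

(* The C_0-semigroup generated by the Laplacian on L^2, which is the closure
   of the Laplacian on smooth functions. *)
Definition torus_heat_semigroup {R : realType} {N : nat}
    {H : completeNormedModType R[i]} (iota : ('rV[R]_N -> R[i]) -> H)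
    (S : R -> H -> H) : Prop :=
  C0_semigroup S /\
  generator S = closure [set (iota f, iota (laplacian f)) | f in torus_smooth].

(* [a] is the sequence of heat coefficients of the heat trace [h]:
   h(t) ~ (4 pi t)^(-N/2) sum_k a_k t^(k/2) as t decreases to 0, i.e. the
   remainder after the k = n term is o(t^((n - N)/2)) for every n. *)
Definition heat_coefficients {R : realType} (N : nat) (h : R -> R[i])
    (a : nat -> R[i]) : Prop :=
  forall n : nat,
    cabs (h t - ((4 * pi * t) `^ (- (N%:R / 2)))%:C *
                \sum_(k < n.+1) a k * (t `^ (k%:R / 2))%:C)
      / t `^ ((n%:R - N%:R) / 2) @[t --> 0^'+] --> (0 : R).

(* Main.v *)
(* Write [e_k(x) = exp(i k.x)].  These functions are smooth eigenfunctions of the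
   Laplacian with eigenvalues [-|k|^2], so [S t] multiplies the class of [e_k] by
   [exp(-t |k|^2)], and they are orthogonal in [L^2].  They are total: the
   Hermite-Fejer interpolant of a continuous periodic function on a uniform grid
   is a trigonometric polynomial, and it converges uniformly to the function.
   Hence [S t] is self-adjoint, [<S_t x, x> = |S_(t/2) x|^2], and by Parseval
   the trace of [S t] over any orthonormal basis is the sum of [exp(-t |k|^2)]
   over [k], which is by definition the spectral trace of [T t]. *)

Require Import Defs.
From HB Require Import structures.
From mathcomp Require Import all_boot all_order all_algebra.
From mathcomp Require Import all_classical all_reals all_analysis.
From mathcomp Require Import complex.
From mathcomp Require Import finmap ring lra.

Set Implicit Arguments.
Unset Strict Implicit.
Unset Printing Implicit Defensive.

Import Order.TTheory GRing.Theory Num.Theory.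
Import numFieldNormedType.Exports.

Local Open Scope classical_set_scope.
Local Open Scope ring_scope.
Local Open Scope complex_scope.

(** * Real-valued norms of complex normed spaces *)

Section RealNorm.
Context {R : realType}.
Implicit Types (a : R[i]) (r : R).

(** The semigroup [S] is given through its generator, a derivative at 0 from the right. Its value on
    an eigenvector is recovered by telescoping over a fine subdivision of [[0, t]]. This needs a
    bound on [S] that is uniform for small times, and strong continuity yields one only through the
    uniform boundedness principle.

    Interpolation takes the place of convolution with the Fejer kernel: the approximant is a finite
    sum of values, visibly a trigonometric polynomial. Its error is measured by [1 - cos], which is
    periodic and is damped by the kernel through a purely algebraic identity.

    The sum of [<S_t e, e>] over a basis is the squared Hilbert-Schmidt norm of [S (t / 2)]; this is
    why it does not depend on the basis, which may be uncountable. Since [S t] is positive, it is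
    its own absolute value, and convergence of the Gaussian sum makes it trace class. *)

Lemma cabsE a : `|a| = (cabs a)%:C.
Proof. by rewrite /cabs complexRe; apply/esym/Creal_ReP; rewrite normr_real. Qed.

Lemma cabs_sqrt a : cabs a = Num.sqrt (complex.Re a ^+ 2 + complex.Im a ^+ 2).
Proof. by rewrite /cabs normc_def. Qed.

Lemma cabs_real r : cabs r%:C = `|r|.
Proof. by rewrite cabs_sqrt /= expr0n addr0 sqrtr_sqr. Qed.

Lemma cabs_ge0 a : 0 <= cabs a.
Proof. by rewrite cabs_sqrt sqrtr_ge0. Qed.

Lemma cabsM a b : cabs (a * b) = cabs a * cabs b.
Proof. by apply/complexI; rewrite rmorphM /= -!cabsE normrM. Qed.

(** Norms over the scalars [R[i]] take values in [R[i]], whose order is partial; the real part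
    carries the same information. *)
Definition rnorm {X : normedModType R[i]} (x : X) : R := complex.Re `|x|.

Context {X : normedModType R[i]}.
Implicit Types x y z : X.

Lemma rnormE x : `|x| = (rnorm x)%:C.
Proof. by rewrite /rnorm complexRe; apply/esym/Creal_ReP; rewrite normr_real. Qed.

Lemma rnorm_ge0 x : 0 <= rnorm x.
Proof. by rewrite -ler0c -rnormE. Qed.

Lemma rnorm0 : rnorm (0 : X) = 0.
Proof. by apply/complexI; rewrite -rnormE normr0. Qed.

Lemma rnorm_eq0 x : (rnorm x == 0) = (x == 0).
Proof. by rewrite -(inj_eq (@complexI R)) -rnormE normr_eq0. Qed.

Lemma rnormZ a x : rnorm (a *: x) = cabs a * rnorm x.
Proof. by apply/complexI; rewrite rmorphM /= -cabsE -!rnormE normrZ. Qed.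

Lemma rnormN x : rnorm (- x) = rnorm x.
Proof. by rewrite /rnorm normrN. Qed.

Lemma rnormD x y : rnorm (x + y) <= rnorm x + rnorm y.
Proof. by rewrite -lecR rmorphD /= -!rnormE ler_normD. Qed.

Lemma rnormB x y : rnorm (x - y) <= rnorm x + rnorm y.
Proof. by rewrite -(rnormN y) rnormD. Qed.

Lemma rnorm_distC x y : rnorm (x - y) = rnorm (y - x).
Proof. by rewrite /rnorm distrC. Qed.

Lemma rnorm_distD z x y : rnorm (x - y) <= rnorm (x - z) + rnorm (z - y).
Proof. by rewrite -[x - y](subrKA z) rnormD. Qed.

Lemma gt0_complex_real (e : R[i]) : 0 < e -> 0 < complex.Re e /\ e = (complex.Re e)%:C.
Proof.
case: e => a b; rewrite ltcE /= => /andP[/eqP -> a0]; split => //.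
Qed.

Lemma rnorm_cvgP {T : Type} {F : set_system T} {FF : Filter F} (f : T -> X) x :
  f @ F --> x <-> forall e : R, 0 < e -> \forall t \near F, rnorm (x - f t) < e.
Proof.
rewrite cvgrPdist_lt; split=> H e e0.
  have := H e%:C; rewrite ltcR => /(_ e0).
  by apply: filterS => t; rewrite rnormE ltcR.
have [r0 ->] := gt0_complex_real e0.
by apply: filterS (H _ r0) => t; rewrite rnormE ltcR.
Qed.

Lemma rnorm_nbhsP x (P : set X) :
  nbhs x P <-> exists2 e : R, 0 < e & forall y, rnorm (x - y) < e -> P y.
Proof.
split.
  move=> /nbhs_normP[e /= e0 eP]; have [r0 er] := gt0_complex_real e0.
  exists (complex.Re e) => // y xy; apply: eP => /=.
  by rewrite er rnormE ltcR.
move=> [e e0 eP]; apply/nbhs_normP; exists e%:C; first by rewrite /= ltcR.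
by move=> y /=; rewrite rnormE ltcR => /eP.
Qed.

Lemma rnorm_small_eq x y : (forall e : R, 0 < e -> rnorm (x - y) <= e) -> x = y.
Proof.
move=> h; apply/eqP; rewrite -subr_eq0 -rnorm_eq0 eq_le rnorm_ge0 andbT.
by apply/ler_addgt0Pl => e e0; rewrite addr0; exact: h.
Qed.

Lemma rnorm_closed_mem (D : set X) x : closed D ->
  (forall e : R, 0 < e -> exists2 y, D y & rnorm (x - y) < e) -> D x.
Proof.
move=> cD h; apply: cD => P /rnorm_nbhsP[e e0 eP].
by have [y Dy xy] := h _ e0; exists y; split => //; exact: eP.
Qed.

Lemma rnorm_dense (D : set X) x : dense D ->
  forall e : R, 0 < e -> exists2 y, D y & rnorm (x - y) < e.
Proof.
move=> dD e e0; have [||y [ey Dy]] := dD (interior [set y | rnorm (x - y) < e]).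
- by exists x; apply/rnorm_nbhsP; exists e.
- exact: open_interior.
by exists y => //; exact: (interior_subset ey).
Qed.

End RealNorm.

(** Convergence with a rate: [r] only has to take arbitrarily small values, and [r n] still bounds
    the distance from [u n] to the limit. *)
Lemma rnorm_complete {R : realType} {X : completeNormedModType R[i]}
    (u : nat -> X) (r : nat -> R) :
    (forall n m, (n <= m)%N -> rnorm (u n - u m) <= r n) ->
    (forall e : R, 0 < e -> exists n, r n < e) ->
  exists l, forall n, rnorm (u n - l) <= r n.
Proof.
move=> ur r0.
have /cauchy_cvg/cvg_ex[l ul] : cauchy (u @ \oo).
  apply: cauchy_exP => e e0; have [e0' er] := gt0_complex_real e0.
  have [n rn] := r0 _ e0'; exists (u n).
  exists n => // m /= nm; rewrite -ball_normE /= rnormE er ltcR.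
  exact: le_lt_trans (ur _ _ nm) rn.
exists l => n; apply/ler_addgt0Pl => e e0.
have [m [nm um]] : exists m, (n <= m)%N /\ rnorm (l - u m) < e.
  have := (@rnorm_cvgP _ _ _ _ _ u l).1 ul e e0.
  move=> [k _ km]; exists (maxn n k); rewrite leq_maxl; split => //.
  by apply: km; rewrite /= leq_maxr.
rewrite (le_trans (rnorm_distD (u m) _ _)) //.
rewrite [leRHS]addrC; apply: lerD; first exact: ur.
by rewrite rnorm_distC ltW.
Qed.

(** * Strongly continuous semigroups *)

Lemma near_right0P {R : realType} (P : set R) :
  (\forall t \near 0^'+, P t) <->
  exists2 d : R, 0 < d & forall t, 0 < t -> t < d -> P t.
Proof.
split.
  move=> /nbhs_ballP[d /= d0 dP]; exists d => // t t0 td; apply: dP => //=.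
  by rewrite /ball /= sub0r normrN gtr0_norm.
move=> [d d0 dP]; near=> t; apply: dP => //.
Unshelve. all: end_near. Qed.

Lemma linear_map0 {K : pzRingType} {X Y : lmodType K} (F : X -> Y) :
  linear F -> F 0 = 0.
Proof. by move=> /(_ (-1) 0 0); rewrite scaler0 addr0 scaleN1r addNr. Qed.

Lemma linear_mapB {K : pzRingType} {X Y : lmodType K} (F : X -> Y) x y :
  linear F -> F (x - y) = F x - F y.
Proof. by move=> Fl; rewrite addrC -scaleN1r Fl scaleN1r addrC. Qed.

Lemma linear_mapZ {K : pzRingType} {X Y : lmodType K} (F : X -> Y) c x :
  linear F -> F (c *: x) = c *: F x.
Proof. by move=> Fl; rewrite -[c *: x]addr0 Fl linear_map0// addr0. Qed.

(* The uniform boundedness principle, by nested balls: otherwise there are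
   balls B_n and times t_n <= 1/(n+1) with n <= |S t_n w| for w in B_n, and the
   orbit of a common point of the B_n is unbounded near 0. *)
Lemma C0_semigroup_locally_bounded {R : realType}
    {X : completeNormedModType R[i]} (S : R -> X -> X) : C0_semigroup S ->
  exists2 d : R, 0 < d &
    exists M : R, forall s x, 0 <= s -> s <= d -> rnorm (S s x) <= M * rnorm x.
Proof.
move=> [Slc S0 SD Sc]; apply: contrapT => unb.
(* [yr] is a ball, given by centre and radius; [zt] is the next ball with its time. Without a next
   ball at stage [n], every [S t] with [t <= 1/(n+1)] would be bounded by [n] on the ball of half
   the radius. *)
have step : forall n (yr : X * R), 0 < yr.2 -> exists zt : (X * R) * R,
    [/\ 0 <= zt.2 <= n.+1%:R^-1, 0 < zt.1.2 <= yr.2 / 2,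
        rnorm (zt.1.1 - yr.1) <= yr.2 / 2 &
        forall w, rnorm (w - zt.1.1) <= zt.1.2 -> n%:R <= rnorm (S zt.2 w)].
  move=> n [y r] /= r0; apply: contrapT => no; apply: unb.
  exists n.+1%:R^-1; first by rewrite invr_gt0.
  have bnd t z : 0 <= t -> t <= n.+1%:R^-1 -> rnorm (z - y) <= r / 2 ->
      rnorm (S t z) <= n%:R.
    move=> t0 tn zy; rewrite leNgt; apply/negP => nS; apply: no.
    have [_ /(_ z)] := Slc t t0.
    move=> /rnorm_cvgP/(_ (rnorm (S t z) - n%:R)); rewrite subr_gt0.
    move=> /(_ nS)/rnorm_nbhsP[e e0 eP].
    exists ((z, Num.min (e / 2) (r / 2)), t) => /=; split => //.
    - by rewrite t0 tn.
    - by rewrite lt_min ge_min lexx orbT andbT; apply/andP; split; lra.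
    - move=> w; rewrite le_min => /andP[wz _].
      have zw : rnorm (z - w) < e by rewrite rnorm_distC (le_lt_trans wz)//; lra.
      have := eP _ zw.
      have := rnormD (S t z - S t w) (S t w); rewrite subrK; lra.
  (* Both [y] and [y + c x] lie in that half ball, [c |x|] being [r / 2]; subtracting their images
     gives [c |S t x| <= 2 n]. *)
  exists (4 * n%:R / r) => t x t0 tn.
  have [->|x0] := eqVneq x 0.
    by rewrite linear_map0 ?rnorm0 ?mulr0//; case: (Slc t t0).
  have nx : 0 < rnorm x by rewrite lt_neqAle rnorm_ge0 eq_sym rnorm_eq0 x0.
  pose c : R := r / 2 / rnorm x.
  have c0 : 0 < c by rewrite !divr_gt0.
  have h1 : rnorm (S t (c%:C *: x + y)) <= n%:R.
    apply: bnd => //; rewrite addrK rnormZ cabs_real gtr0_norm//.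
    by rewrite /c divfK// gt_eqF.
  have h2 : rnorm (S t y) <= n%:R by apply: bnd => //; rewrite subrr rnorm0 divr_ge0 ?ltW.
  have [Sl _] := Slc t t0; rewrite Sl in h1.
  have h3 : c * rnorm (S t x) <= 2 * n%:R.
    rewrite -(gtr0_norm c0) -cabs_real -rnormZ.
    have := rnormB (c%:C *: S t x + S t y) (S t y); rewrite addrK; lra.
  move: h3; rewrite -ler_pdivlMl// => /le_trans; apply.
  by rewrite le_eqVlt; apply/orP; left; apply/eqP; rewrite /c; field; rewrite !gt_eqF.
have next n (yr : {yr : X * R | 0 < yr.2}) : {zt : (X * R) * R |
    [/\ 0 <= zt.2 <= n.+1%:R^-1, 0 < zt.1.2 <= (sval yr).2 / 2,
        rnorm (zt.1.1 - (sval yr).1) <= (sval yr).2 / 2 &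
        forall w, rnorm (w - zt.1.1) <= zt.1.2 -> n%:R <= rnorm (S zt.2 w)]}.
  by apply: cid; apply: step; exact: (svalP yr).
have nextP n yr : 0 < (sval (next n yr)).1.2 by case: (svalP (next n yr)) => _ /andP[].
pose u := fix u n : {yr : X * R | 0 < yr.2} := match n with
  | 0%N => exist _ (0, 1) ltr01
  | n.+1 => exist _ (sval (next n (u n))).1 (nextP n (u n)) end.
pose y n := (sval (u n)).1; pose r n := (sval (u n)).2.
have yP n : exists t, [/\ 0 <= t <= n.+1%:R^-1, 0 < r n.+1 <= r n / 2,
    rnorm (y n.+1 - y n) <= r n / 2 &
    forall w, rnorm (w - y n.+1) <= r n.+1 -> n%:R <= rnorm (S t w)].
  by exists (sval (next n (u n))).2; exact: (svalP (next n (u n))).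
have r01 : r 0%N = 1 by [].
clearbody y r; clear u next nextP.
have rS n : r n.+1 <= r n / 2 by have [t [_ /andP[]]] := yP n.
have r0 n : 0 < r n.
  by case: n => [|n]; [rewrite r01|have [t [_ /andP[]]] := yP n].
have yS n : rnorm (y n.+1 - y n) <= r n / 2 by have [t []] := yP n.
(* Each step moves the centre by at most [r n / 2 <= r n - r (n+1)], which telescopes; so the balls
   are nested. *)
have yr n k : rnorm (y n - y (n + k)%N) <= r n - r (n + k)%N.
  elim: k => [|k IH]; first by rewrite addn0 !subrr rnorm0.
  have := rnorm_distD (y (n + k)%N) (y n) (y (n + k.+1)%N).
  have := yS (n + k)%N; rewrite (rnorm_distC (y _.+1)).
  by have := rS (n + k)%N; rewrite !addnS; lra.
have r2 n : r n <= (1/2) ^+ n.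
  elim: n => [|n IH]; first by rewrite expr0 r01.
  by rewrite exprS; have := rS n; lra.
have [|e e0|l yl] := @rnorm_complete _ _ y r.
- move=> n m /subnKC <-; apply: (le_trans (yr _ _)).
  by have := r0 (n + (m - n))%N; lra.
- have : (1/2 : R) ^+ n @[n --> \oo] --> 0.
    by apply: cvg_expr; rewrite ger0_norm; [lra..].
  move=> /cvgrPdist_lt/(_ e e0)[n _ /(_ n (leqnn n))] /=.
  have half0 : 0 <= 1/2 :> R by lra.
  rewrite sub0r normrN ger0_norm ?exprn_ge0//.
  by move=> ne; exists n; exact: le_lt_trans (r2 n) ne.
(* Strong continuity at the common point bounds its orbit by [|l| + 1] on [[0, d)]; any [n] above
   this bound with [1/(n+1) < d] is contradictory. *)
have /rnorm_cvgP/(_ 1 ltr01)/near_right0P[d d0 dP] := Sc l.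
have Sb t : 0 <= t -> t < d -> rnorm (S t l) <= rnorm l + 1.
  rewrite le_eqVlt => /orP[/eqP <- _|t0 td]; first by rewrite S0; lra.
  have := dP _ t0 td; have := rnormB l (l - S t l); rewrite subKr; lra.
have [n [n1 n2]] : exists n, rnorm l + 1 < n%:R /\ n.+1%:R^-1 < d.
  exists (Num.truncn (rnorm l + 1 + d^-1)).+1; set N := (_.+1).
  have h : rnorm l + 1 + d^-1 < N%:R by exact: truncnS_gt.
  have l0 := rnorm_ge0 l; have d1 : 0 < d^-1 by rewrite invr_gt0.
  split; first by lra.
  by rewrite invf_plt ?posrE// (@lt_le_trans _ _ N%:R) ?ler_nat//; lra.
have [t [/andP[t0 tn] _ _ /(_ l)]] := yP n.
rewrite rnorm_distC => /(_ (yl n.+1)).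
by have := Sb _ t0 (le_lt_trans tn n2); lra.
Qed.

Lemma iter_eigen {R : realType} {X : lmodType R[i]} (F : X -> X) (mu : R[i]) x n :
  linear F -> F x = mu *: x -> iter n F x = mu ^+ n *: x.
Proof.
move=> Fl Fx; elim: n => [|n IH]; first by rewrite expr0 scale1r.
by rewrite iterS IH linear_mapZ// Fx scalerA -exprSr.
Qed.

Lemma C0_semigroup_iter {R : realType} {X : normedModType R[i]}
    (S : R -> X -> X) (h : R) n x : C0_semigroup S -> 0 <= h ->
  S (n%:R * h) x = iter n (S h) x.
Proof.
move=> [_ S0 SD _] h0; elim: n x => [|n IH] x; first by rewrite mul0r S0.
by rewrite iterS -IH -SD// ?mulr_ge0// -natr1 mulrDl mul1r addrC.
Qed.

(** With [mu = exp (- h q)], the difference [S (n h) x - mu^n x] telescopes into [n] terms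
    [mu^(n-1-j) S (j h) (S h x - mu x)]. Both [S h x] and [mu x] are [x - h q x + o(h)], and [S] is
    bounded for small times, so the total is [n o(h)], which vanishes in the limit with [n h = t]
    fixed. *)
Lemma C0_semigroup_eigenvector {R : realType} {X : completeNormedModType R[i]}
    (S : R -> X -> X) (x : X) (q : R) : C0_semigroup S -> 0 <= q ->
  generator S (x, (- q)%:C *: x) ->
  forall t, 0 <= t -> S t x = (expR (- t * q))%:C *: x.
Proof.
move=> CS q0 gx; have [Slc S0 SD Sc] := CS.
have [d d0 [M0 SM0]] := C0_semigroup_locally_bounded CS.
pose M := `|M0| + 1; have M_gt0 : 0 < M by rewrite ltr_wpDl.
have SM s y : 0 <= s -> s <= d -> rnorm (S s y) <= M * rnorm y.
  move=> s0 sd; apply: (le_trans (SM0 _ _ s0 sd)).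
  by rewrite ler_wpM2r ?rnorm_ge0// (le_trans (ler_norm _))// lerDl.
have tel h n : 0 <= h -> n%:R * h <= d ->
    rnorm (S (n%:R * h) x - (expR (- h * q) ^+ n)%:C *: x) <=
    n%:R * M * rnorm (S h x - (expR (- h * q))%:C *: x).
  move=> h0; elim: n => [|n IH] nd.
    by rewrite !mul0r S0 expr0 scale1r subrr rnorm0.
  have nh0 : 0 <= n%:R * h by rewrite mulr_ge0.
  have nhd : n%:R * h <= d.
    by apply: le_trans nd; rewrite ler_wpM2r// ler_nat.
  set mu := expR (- h * q).
  have mu1 : 0 <= mu <= 1.
    by rewrite expR_ge0 expR_le1 mulNr oppr_le0 mulr_ge0.
  have [Sl _] := Slc _ nh0.
  have -> : S (n.+1%:R * h) x - (mu ^+ n.+1)%:C *: x =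
      S (n%:R * h) (S h x - mu%:C *: x) +
      mu%:C *: (S (n%:R * h) x - (mu ^+ n)%:C *: x).
    rewrite -natr1 mulrDl mul1r SD// (linear_mapB _ _ Sl) (linear_mapZ _ _ Sl).
    by rewrite scalerBr scalerA -rmorphM -exprS /= subrKA.
  apply: (le_trans (rnormD _ _)); rewrite rnormZ cabs_real ger0_norm ?expR_ge0//.
  rewrite -natr1 mulrDl mul1r mulrDl [leRHS]addrC; apply: lerD; first exact: SM.
  apply: le_trans (IH nhd); rewrite ler_piMl ?rnorm_ge0//.
  by case/andP: mu1.
have small t : 0 < t -> t <= d -> S t x = (expR (- t * q))%:C *: x.
  move=> t0 td; apply: rnorm_small_eq => e e0.
  (* The telescoped error will be at most [n M h c (1 + |x|)] with [n h = t]; this [c] makes it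
     equal to [e]. *)
  pose c := e / (t * M * (1 + rnorm x)).
  have x1 : 0 < 1 + rnorm x by rewrite ltr_wpDr ?rnorm_ge0.
  have c0 : 0 < c by rewrite /c !(divr_gt0, mulr_gt0).
  move/rnorm_cvgP: gx => /= /(_ c c0)/near_right0P[d1 d10 dP].
  (* [h B < 1] forces both [h < d1], where the difference quotient is within [c] of its limit, and
     [h q^2 <= c], which controls the quadratic error of the exponential. *)
  pose B := d1^-1 + q ^+ 2 / c.
  have d1V : 0 <= d1^-1 by rewrite invr_ge0 ltW.
  have qc : 0 <= q ^+ 2 / c by rewrite divr_ge0 ?sqr_ge0// ltW.
  have B0 : 0 <= B by rewrite addr_ge0.
  pose n := (Num.truncn (t * B)).+1; pose h : R := t / n%:R.
  have nB : t * B < n%:R by exact: truncnS_gt.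
  have n0 : 0 < n%:R :> R by [].
  have h0 : 0 < h by rewrite divr_gt0.
  have hB : h * B < 1 by rewrite /h mulrAC ltr_pdivrMr// mul1r.
  have hd1 : h < d1.
    rewrite -[ltRHS]mul1r -ltr_pdivrMr//; apply: le_lt_trans hB.
    by rewrite ler_wpM2l ?(ltW h0)// /B lerDl.
  have hq : h * q ^+ 2 <= c.
    rewrite -[leRHS]mul1r -ler_pdivrMr// -mulrA; apply: le_trans (ltW hB).
    by rewrite ler_wpM2l ?(ltW h0)// /B lerDr.
  have nh : n%:R * h = t by rewrite /h mulrC divfK// gt_eqF.
  have := tel h n (ltW h0); rewrite nh => /(_ td).
  rewrite -expRM_natl mulrA mulrN nh => /le_trans; apply.
  set mu := expR (- h * q).
  (* From [1 - u <= exp (- u) <= 1 / (1 + u)], the linear approximation at [u = h q] is off by at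
     most [u^2]. *)
  have hmu : `|1 - h * q - mu| <= h * c.
    have hq0 : 0 <= h * q by rewrite mulr_ge0// ltW.
    have l1 : 1 - h * q <= mu by rewrite -mulNr expR_ge1Dx.
    have l2 : mu * (1 + h * q) <= 1.
      rewrite /mu mulNr expRN mulrC ler_pdivrMr ?expR_gt0// mul1r.
      exact: expR_ge1Dx.
    rewrite ler0_norm; last lra.
    have l3 : mu <= 1 by nra.
    have l4 : mu <= 1 - h * q + (h * q) ^+ 2 by nra.
    have : (h * q) ^+ 2 <= h * c by rewrite exprMn [h ^+ 2]expr2 -mulrA ler_pM2l.
    lra.
  have hS : rnorm (S h x - x + (h * q)%:C *: x) <= h * c.
    have := dP h h0 hd1.
    have -> : S h x - x + (h * q)%:C *: x =
      (- h)%:C *: ((- q)%:C *: x - (h%:C)^-1 *: (S h x - x)).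
      rewrite scalerBr !scalerA addrC; congr (_ + _).
        by rewrite -rmorphM mulrNN.
      rewrite rmorphN mulNr mulfV ?scaleN1r ?opprK//.
      by rewrite (inj_eq (@complexI R) _ 0) gt_eqF.
    by rewrite rnormZ cabs_real normrN gtr0_norm// => /ltW; rewrite ler_pM2l.
  have rho : rnorm (S h x - mu%:C *: x) <= h * c * (1 + rnorm x).
    have -> : S h x - mu%:C *: x =
      (S h x - x + (h * q)%:C *: x) + (1 - h * q - mu)%:C *: x.
      rewrite !rmorphB rmorph1 /= !scalerBl scale1r.
      by rewrite -!addrA; congr (_ + _); rewrite (addrCA (_ *: x)) addKr addNKr.
    apply: (le_trans (rnormD _ _)); rewrite mulrDr mulr1; apply: lerD => //.
    by rewrite rnormZ cabs_real ler_wpM2r// rnorm_ge0.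
  apply: (@le_trans _ _ (n%:R * M * (h * c * (1 + rnorm x)))).
    by rewrite ler_wpM2l// mulr_ge0// ltW.
  rewrite le_eqVlt; apply/orP; left; apply/eqP.
  by rewrite /c -nh; field; rewrite !gt_eqF.
move=> t; rewrite le_eqVlt => /orP[/eqP<-|t0].
  by rewrite S0 oppr0 mul0r expR0 scale1r.
(* Times beyond the bounded range are reached by iterating [S (t / n)] with [t / n <= d]. *)
pose n := (Num.truncn (t / d)).+1.
have n0 : 0 < n%:R :> R by [].
have nd : t / n%:R <= d.
  by rewrite ler_pdivrMr// mulrC -ler_pdivrMr// ltW// truncnS_gt.
have tn0 : 0 < t / n%:R by rewrite divr_gt0.
have {1}-> : t = n%:R * (t / n%:R) by rewrite mulrC divfK// gt_eqF.
rewrite C0_semigroup_iter ?(ltW tn0)//.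
have [Sl _] := Slc _ (ltW tn0).
rewrite (iter_eigen _ Sl (small _ tn0 nd)) -rmorphXn -expRM_natl; congr (_ %:C *: _).
by congr expR; field; rewrite gt_eqF.
Qed.

(** * Parseval identity *)

Section InnerProduct.
Context {R : realType} {H : normedModType R[i]} (ip : H -> H -> R[i]).
Hypothesis ipP : inner_product ip.
Implicit Types (x y z e : H) (a : R[i]).

Let ip_lin a x y z : ip (a *: x + y) z = a * ip x z + ip y z.
Proof. by case: ipP. Qed.

Lemma ipC x y : ip y x = conjc (ip x y).
Proof. by case: ipP. Qed.

Lemma ip_rnorm x : ip x x = (rnorm x ^+ 2)%:C.
Proof. by case: ipP => _ _ ->; rewrite rnormE rmorphXn. Qed.

Lemma ip0l z : ip 0 z = 0.
Proof. by have := ip_lin (-1) 0 0 z; rewrite scaler0 addr0 mulN1r addNr. Qed.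

Lemma ipDl x y z : ip (x + y) z = ip x z + ip y z.
Proof. by rewrite -[x]scale1r ip_lin mul1r scale1r. Qed.

Lemma ipZl a x z : ip (a *: x) z = a * ip x z.
Proof. by rewrite -[_ *: _]addr0 ip_lin ip0l addr0. Qed.

Lemma ipBl x y z : ip (x - y) z = ip x z - ip y z.
Proof. by rewrite ipDl -scaleN1r ipZl mulN1r. Qed.

Lemma ip0r z : ip z 0 = 0. Proof. by rewrite ipC ip0l conjc0. Qed.

Lemma ipDr x y z : ip z (x + y) = ip z x + ip z y.
Proof. by rewrite ipC ipDl rmorphD /= -!ipC. Qed.

Lemma ipZr a x z : ip z (a *: x) = conjc a * ip z x.
Proof. by rewrite ipC ipZl rmorphM /= -!ipC. Qed.

Lemma ipBr x y z : ip z (x - y) = ip z x - ip z y.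
Proof. by rewrite ipC ipBl rmorphB /= -!ipC. Qed.

Lemma sqr_cabs a : (cabs a ^+ 2)%:C = a * conjc a.
Proof. by rewrite -sqr_normc cabsE rmorphXn. Qed.

Lemma cabs_ipC x y : cabs (ip x y) = cabs (ip y x).
Proof. by rewrite ipC /cabs normcJ. Qed.

Lemma cauchy_schwarz x y : cabs (ip x y) <= rnorm x * rnorm y.
Proof.
have [->|y0] := eqVneq y 0.
  by rewrite ip0r rnorm0 mulr0 /cabs normr0.
have ny : 0 < rnorm y by rewrite lt_neqAle rnorm_ge0 eq_sym rnorm_eq0 y0.
pose c := ip x y / (rnorm y ^+ 2)%:C.
have yC : (rnorm y ^+ 2)%:C != 0 :> R[i].
  by rewrite (inj_eq (@complexI R) _ 0) sqrf_eq0 gt_eqF.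
have : ip (x - c *: y) (x - c *: y) =
    (rnorm x ^+ 2 - cabs (ip x y) ^+ 2 / rnorm y ^+ 2)%:C.
  have subdivC (u v w : R) : (u - v / w)%:C = u%:C - v%:C / w%:C.
    by rewrite rmorphB rmorphM fmorphV.
  rewrite ipBl ipZl !ipBr !ipZr (ipC x y) !ip_rnorm subdivC sqr_cabs /c.
  have -> (u v : R[i]) : conjc (u / v) = conjc u / conjc v.
    by rewrite rmorphM fmorphV.
  rewrite conjc_real; move: (_ ^+ 2)%:C yC => d d0.
  by field.
rewrite ip_rnorm => /complexI h.
have : 0 <= rnorm x ^+ 2 - cabs (ip x y) ^+ 2 / rnorm y ^+ 2.
  by rewrite -h sqr_ge0.
rewrite subr_ge0 ler_pdivrMr ?exprn_gt0// -exprMn.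
by rewrite ler_sqr// nnegrE ?mulr_ge0 ?rnorm_ge0 ?cabs_ge0.
Qed.

Lemma rnormD_sqr x y : ip x y = 0 -> rnorm (x + y) ^+ 2 = rnorm x ^+ 2 + rnorm y ^+ 2.
Proof.
move=> xy; apply/complexI; rewrite -ip_rnorm ipDl !ipDr (ipC x y) xy conjc0.
by rewrite addr0 add0r !ip_rnorm rmorphD.
Qed.

Lemma cabsD a b : cabs (a + b) <= cabs a + cabs b.
Proof. by rewrite -lecR rmorphD /= -!cabsE ler_normD. Qed.

Section Orthonormal.
Variable E : set H.
Hypothesis E_orth : forall e f, E e -> E f -> ip e f = (e == f)%:R.

Definition ocomb (c : H -> R[i]) (s : seq H) : H := \sum_(e <- s) c e *: e.

Lemma ocomb_coef c s e : uniq s -> {in s, forall f, E f} -> E e ->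
  ip (ocomb c s) e = if e \in s then c e else 0.
Proof.
move=> us sE Ee; elim: s us sE => [|f s IH] /=; first by rewrite /ocomb big_nil ip0l.
move=> /andP[fs us] sE; rewrite /ocomb big_cons ipDl ipZl -/(ocomb c s).
rewrite IH// => [|g gs]; last by apply: sE; rewrite inE gs orbT.
rewrite E_orth//; last by apply: sE; rewrite mem_head.
rewrite inE [e == f]eq_sym.
case: eqVneq => [<-|_] /=; first by rewrite mulr1 (negPf fs) addr0.
by rewrite mulr0 add0r.
Qed.

Lemma rnorm_onb e : E e -> rnorm e = 1.
Proof.
move=> Ee; have := ip_rnorm e; rewrite E_orth// eqxx => /esym/complexI/eqP.
rewrite sqrf_eq1 => /orP[/eqP//|/eqP e1].
by have := rnorm_ge0 e; rewrite e1 lerNr oppr0 ler10.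
Qed.

Lemma ocomb_sqr c s : uniq s -> {in s, forall f, E f} ->
  rnorm (ocomb c s) ^+ 2 = \sum_(e <- s) cabs (c e) ^+ 2.
Proof.
elim: s => [|f s IH] /=; first by rewrite /ocomb !big_nil rnorm0 expr0n.
move=> /andP[fs us] sE; have sE' : {in s, forall f, E f}.
  by move=> g gs; apply: sE; rewrite inE gs orbT.
have Ef : E f by apply: sE; rewrite mem_head.
rewrite /ocomb !big_cons -/(ocomb c s) rnormD_sqr; last first.
  by rewrite ipZl ipC ocomb_coef// (negPf fs) conjc0 mulr0.
by rewrite IH// rnormZ rnorm_onb// mulr1.
Qed.

Lemma bessel x s : uniq s -> {in s, forall f, E f} ->
  \sum_(e <- s) cabs (ip x e) ^+ 2 <= rnorm x ^+ 2.
Proof.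
move=> us sE; set y := ocomb (ip x) s.
have xy : ip (x - y) y = 0.
  (* [y] involves all of [s], so the induction runs over lists [t] contained in a fixed [s]. *)
  suff h t : {subset t <= s} -> ip (x - y) (ocomb (ip x) t) = 0 by exact: h.
  elim: t => [|f t IH] ts; first by rewrite /ocomb big_nil ip0r.
  have fs : f \in s by apply: ts; rewrite mem_head.
  rewrite /ocomb big_cons ipDr ipZr -/(ocomb _ t) IH => [|g gt]; last first.
    by apply: ts; rewrite inE gt orbT.
  by rewrite ipBl /y ocomb_coef ?fs ?subrr ?mulr0 ?addr0//; exact: sE.
by rewrite -ocomb_sqr// -[in leRHS](subrK y x) rnormD_sqr// lerDr sqr_ge0.
Qed.

End Orthonormal.
End InnerProduct.

Lemma small_rational {R : realType} (c e : R) : 0 < e -> exists n : nat, c / n.+1%:R < e.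
Proof.
move=> e0; exists (Num.truncn (c / e)); rewrite ltr_pdivrMr// mulrC -ltr_pdivrMr//.
exact: truncnS_gt.
Qed.

(** Bessel gives one inequality and makes the supremum finite. For the other, finite sets [F n]
    nearly exhaust the sum, the partial Fourier sums over them are Cauchy, and their limit has the
    coefficients of [x], hence is [x] by maximality. *)
Lemma parseval {R : realType} {H : completeNormedModType R[i]}
    (ip : H -> H -> R[i]) (E : set H) x :
  inner_product ip -> orthonormal_basis ip E ->
  (\esum_(e in E) (cabs (ip x e) ^+ 2)%:E)%E = (rnorm x ^+ 2)%:E.
Proof.
move=> ipP [Eo Em]; set s := esum _ _.
have fsum X : fsets E X -> (\sum_(e \in X) (cabs (ip x e) ^+ 2)%:E)%E =
    (\sum_(e <- (fset_set X : seq H)) cabs (ip x e) ^+ 2)%:E /\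
    {in (fset_set X : seq H), forall f, E f}.
  move=> [fX XE]; rewrite fsbig_finite//= sumEFin; split => // f.
  by rewrite in_fset_set// => /set_mem/XE.
have s_le : (s <= (rnorm x ^+ 2)%:E)%E.
  apply: ub_ereal_sup => _ [X /fsum[-> XE]] <-; rewrite lee_fin.
  by apply: (bessel ipP Eo) => //; exact: fset_uniq.
have s_ge0 : (0 <= s)%E by apply: esum_ge0 => e _; rewrite lee_fin sqr_ge0.
have s_fin : s \is a fin_num by rewrite ge0_fin_numE// (le_lt_trans s_le)// ltry.
pose sg := fine s; have sE : s = sg%:E by rewrite fineK.
have ub t : uniq t -> {in t, forall f, E f} ->
    \sum_(e <- t) cabs (ip x e) ^+ 2 <= sg.
  move=> ut tE; rewrite -lee_fin -sE; apply: esum_ge.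
  exists [set` t]; first by split; [exact: finite_seq|move=> f /= /tE].
  by rewrite -fsbig_seq//= sumEFin.
pose d n : R := 1 / n.+1%:R.
have d0 n : 0 < d n by rewrite divr_gt0.
(* A deficit of [d n ^+ 2] in the sum of squares bounds by [d n] the norm of any partial Fourier sum
   outside [F n]. *)
have /choice[F FP] : forall n, exists t : seq H, [/\ uniq t,
    {in t, forall f, E f} & sg - d n ^+ 2 < \sum_(e <- t) cabs (ip x e) ^+ 2].
  move=> n; have [_ [X fX <-]] : exists2 y, [set (\sum_(e \in X)
      (cabs (ip x e) ^+ 2)%:E)%E | X in fsets E] y & (s - (d n ^+ 2)%:E < y)%E.
    exact: ub_ereal_sup_adherent (exprn_gt0 _ (d0 n)) s_fin.
  have [-> XE] := fsum _ fX; rewrite sE -EFinB lte_fin => h.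
  by exists (fset_set X : seq H); split => //; exact: fset_uniq.
have tail n t : uniq t -> {in t, forall f, E f} -> {in t, forall f, f \notin F n} ->
    \sum_(e <- t) cabs (ip x e) ^+ 2 <= d n ^+ 2.
  move=> ut tE tF; have [uF FE Fl] := FP n.
  have := ub (F n ++ t); rewrite big_cat /= cat_uniq uF ut andbT /=.
  have -> : ~~ has (mem (F n)) t by apply/hasPn.
  have FtE : {in F n ++ t, forall f, E f}.
    by move=> f; rewrite mem_cat => /orP[/FE|/tE].
  by move=> /(_ isT FtE); lra.
pose y n := ocomb (ip x) (F n).
(* [A n m] is [F m] without [F n]. The sums [y n] and [y m] differ only by the terms over [A m n]
   and [A n m], of norm at most [d m] and [d n]; this gives the rate [2 / (n+1)] for [n <= m]. *)
pose A n m := [seq e <- F m | e \notin F n].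
have yA n m : y n - y m = ocomb (ip x) (A m n) - ocomb (ip x) (A n m).
  apply/eqP; rewrite subr_eq addrAC -subr_eq opprK; apply/eqP.
  rewrite /y /ocomb [RHS]addrC -!big_cat /=; apply: perm_big.
  have [uF FE _] := FP n; have [uG GE _] := FP m.
  apply: uniq_perm.
  - rewrite cat_uniq uF filter_uniq ?andbT//=.
    by apply/hasPn => f; rewrite mem_filter => /andP[].
  - rewrite cat_uniq uG filter_uniq ?andbT//=.
    by apply/hasPn => f; rewrite mem_filter => /andP[].
  by move=> f; rewrite !mem_cat !mem_filter; do 2 case: (f \in _).
have Ale n m : rnorm (ocomb (ip x) (A n m)) <= d n.
  have [uG GE _] := FP m.
  have AE : {in A n m, forall f, E f}.
    by move=> f; rewrite mem_filter => /andP[_ /GE].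
  rewrite -ler_sqr ?nnegrE ?rnorm_ge0 ?(ltW (d0 n))//.
  rewrite (ocomb_sqr ipP Eo)// ?filter_uniq//; apply: tail => //.
    exact: filter_uniq.
  by move=> f; rewrite mem_filter => /andP[].
have [n m nm|e e0|l yl] := @rnorm_complete _ _ y (fun n => 2 / n.+1%:R).
- rewrite yA; apply: (le_trans (rnormB _ _)).
  have -> : 2 / n.+1%:R = d n + d n by rewrite /d -mulrDl; congr (_ / _); ring.
  apply: lerD => //; apply: (le_trans (Ale _ _)).
  by rewrite /d ler_pM2l// lef_pV2 ?posrE// ler_nat.
- exact: small_rational.
have xl : x - l = 0.
  apply: Em => e Ee.
  (* One third comes from [x - y n], whose coefficient at [e] is zero or a tail of one term; two
     thirds come from the distance of [y n] to [l]. *)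
  have h n : cabs (ip (x - l) e) <= 3 / n.+1%:R.
    rewrite -(subrKA (y n)) ipDl//; apply: (le_trans (cabsD _ _)).
    have -> : 3 / n.+1%:R = d n + 2 / n.+1%:R by rewrite /d -mulrDl; congr (_ / _); ring.
    apply: lerD; last first.
      apply: (le_trans (cauchy_schwarz ipP _ _)).
      by rewrite (rnorm_onb ipP Eo Ee) mulr1.
    have [uF FE _] := FP n; rewrite ipBl// (ocomb_coef ipP Eo)//.
    case: ifPn => eF; first by rewrite subrr /cabs normr0 /= ltW.
    rewrite subr0 -ler_sqr ?nnegrE ?cabs_ge0 ?(ltW (d0 n))//.
    have := @tail n [:: e]; rewrite big_seq1; apply => //.
      by move=> f; rewrite inE => /eqP ->.
    by move=> f; rewrite inE => /eqP ->.
  apply/eqP; rewrite -normr_eq0 cabsE (inj_eq (@complexI R) _ 0).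
  rewrite eq_le cabs_ge0 andbT; apply/ler_addgt0Pl => c c0; rewrite addr0.
  by have [n /ltW] := small_rational 3 c0; exact: le_trans.
have sg0 : 0 <= sg by rewrite -lee_fin -sE.
apply/eqP; rewrite eq_le s_le sE lee_fin /=.
rewrite -[leRHS]sqr_sqrtr// ler_sqr ?nnegrE ?rnorm_ge0 ?sqrtr_ge0//.
apply/ler_addgt0Pl => c c0.
have [n nc] := small_rational 2 c0.
have -> : x = (l - y n) + y n by rewrite subrK; apply/eqP; rewrite -subr_eq0 xl.
apply: (le_trans (rnormD _ _)); apply: lerD.
  by rewrite rnorm_distC (le_trans (yl n))// ltW.
rewrite -ler_sqr ?nnegrE ?rnorm_ge0 ?sqrtr_ge0// sqr_sqrtr//.
by have [uF FE _] := FP n; rewrite (ocomb_sqr ipP Eo)// ub.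
Qed.

Lemma esum_swap {R : realType} {T1 T2 : choiceType} (I : set T1) (J : set T2)
    (a : T1 -> T2 -> \bar R) : (forall i j, I i -> J j -> (0 <= a i j)%E) ->
  (\esum_(i in I) \esum_(j in J) a i j = \esum_(j in J) \esum_(i in I) a i j)%E.
Proof.
move=> a0; rewrite !esum_esum//; last by move=> j i Jj Ii; exact: a0.
apply: (@reindex_esum _ _ _ _ _ (fun ji => (ji.2, ji.1))); split.
- by move=> [j i] [].
- by move=> [j i] [j' i'] _ _ [-> ->].
- by move=> [i j] [/= Ii Jj]; exists (j, i).
Qed.

(* The sum is independent of the basis: by Parseval, both sides equal
   the double sum of |<Q e, f>|^2. *)
Lemma hilbert_schmidt_sum {R : realType} {H : completeNormedModType R[i]}
    (ip : H -> H -> R[i]) (E F : set H) (Q : H -> H) :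
  inner_product ip -> orthonormal_basis ip E -> orthonormal_basis ip F ->
  (forall x y, ip (Q x) y = ip x (Q y)) ->
  (\esum_(e in E) (rnorm (Q e) ^+ 2)%:E = \esum_(f in F) (rnorm (Q f) ^+ 2)%:E)%E.
Proof.
move=> ipP bE bF Qsa.
under eq_esum do rewrite -(parseval _ ipP bF).
rewrite esum_swap => [|e f _ _]; last by rewrite lee_fin sqr_ge0.
apply: eq_esum => f _; rewrite -(parseval _ ipP bE).
by apply: eq_esum => e _; rewrite Qsa (cabs_ipC ipP).
Qed.

(** * Trace of a diagonal semigroup *)

Lemma csum_nonneg {R : realType} {I : choiceType} (D : set I) (g : I -> R) :
  (forall i, 0 <= g i) ->
  csum D (fun i => (g i)%:C) = (fine (\esum_(i in D) (g i)%:E)%E)%:C.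
Proof.
have real_sum_nonneg (f : I -> R) : (forall i, 0 <= f i) ->
    real_sum D f = fine (\esum_(i in D) (f i)%:E)%E.
  move=> f0; rewrite /real_sum; set p := esum _ _; set n := esum _ _.
  have ef0 j : [set: I] j -> (0 <= (EFin \o f) j)%E by rewrite lee_fin f0.
  have -> : n = 0%E by apply: esum1 => i _; exact: (ge0_funenegE ef0 (mem_set _)).
  rewrite sube0; congr fine; apply: eq_esum => i _.
  exact: (ge0_funeposE ef0 (mem_set _)).
move=> g0; rewrite /csum /= !real_sum_nonneg//.
by rewrite [X in _ +i* fine X]esum1.
Qed.

Lemma abs_summable_nonneg {R : realType} {I : choiceType} (D : set I) (g : I -> R) :
  (forall i, 0 <= g i) ->
  abs_summable D (fun i => (g i)%:C) = (\esum_(i in D) (g i)%:E < +oo)%E.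
Proof.
move=> g0; rewrite /abs_summable /summable; congr (is_true (_ < _)%E).
by apply: eq_esum => i _; rewrite cabs_real /= normr_id ger0_norm.
Qed.

(** For linear [F] such a set is a closed subspace, so identities between inner products can be
    checked on a total family. *)
Lemma closed_ip_eq {R : realType} {H : normedModType R[i]}
    (ip : H -> H -> R[i]) (F : H -> H) y z : inner_product ip -> continuous F ->
  closed [set x | ip (F x) y = ip x z].
Proof.
move=> ipP Fc x xD; apply/eqP; rewrite -subr_eq0 -normr_eq0 cabsE.
rewrite (inj_eq (@complexI R) _ 0) eq_le cabs_ge0 andbT.
apply/ler_addgt0Pl => e e0; rewrite addr0.
have pos (w : H) : 0 < rnorm w + 1 by rewrite ltr_wpDl// rnorm_ge0.
pose d (w : H) := e / 2 / (rnorm w + 1).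
have d0 w : 0 < d w by rewrite !divr_gt0.
have dM w (r : R) : 0 <= r -> r < d w -> r * rnorm w <= e / 2.
  move=> r0; rewrite ltr_pdivlMr// => /ltW; apply: le_trans.
  by rewrite ler_wpM2l// lerDl.
have /rnorm_cvgP/(_ (d y) (d0 y)) Fx := Fc x.
have xz : \forall w \near x, rnorm (x - w) < d z by apply/rnorm_nbhsP; exists (d z).
have [w [Dw [Fw xw]]] := xD _ (filterI Fx xz).
rewrite -[_ - _](subrKA (ip (F w) y)) {2}Dw -(ipBl ipP) -(ipBl ipP).
apply: (le_trans (cabsD _ _)); rewrite (splitr e); apply: lerD.
  by apply: (le_trans (cauchy_schwarz ipP _ _)); exact: dM (rnorm_ge0 _) Fw.
apply: (le_trans (cauchy_schwarz ipP _ _)); rewrite rnorm_distC.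
exact: dM (rnorm_ge0 _) xw.
Qed.

Section DiagonalSemigroup.
Context {R : realType} {H : completeNormedModType R[i]} {I : choiceType}.
Variables (ip : H -> H -> R[i]) (S : R -> H -> H).
Variables (u : I -> H) (c : R) (q : I -> R).
Hypothesis ipP : inner_product ip.
Hypothesis CS : C0_semigroup S.
Hypothesis c_gt0 : 0 < c.
Hypothesis u_orth : forall k l, ip (u k) (u l) = (c *+ (k == l))%:C.
Hypothesis u_total : forall D : set H, closed D -> D 0 ->
  (forall a x y, D x -> D y -> D (a *: x + y)) -> (forall k, D (u k)) ->
  forall x, D x.
Hypothesis q_ge0 : forall k, 0 <= q k.
Hypothesis u_gen : forall k, generator S (u k, (- q k)%:C *: u k).

Let v k : H := ((Num.sqrt c)^-1)%:C *: u k.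

Let v_orth k l : ip (v k) (v l) = (k == l)%:R.
Proof.
rewrite /v (ipZl ipP) (ipZr ipP) u_orth conjc_real -!rmorphM /= mulrA -expr2.
rewrite exprVn sqr_sqrtr ?ltW//; case: eqVneq => _; last by rewrite mulr0n mulr0.
by rewrite mulr1n mulVf// gt_eqF.
Qed.

Let v_inj : injective v.
Proof.
move=> k l kl; have := v_orth k l; rewrite kl v_orth eqxx.
by case: eqVneq => // _ /eqP; rewrite oner_eq0.
Qed.

Let v_total (D : set H) : closed D -> D 0 ->
  (forall a x y, D x -> D y -> D (a *: x + y)) -> (forall k, D (v k)) ->
  forall x, D x.
Proof.
move=> cD D0 DD Dv; apply: u_total => // k.
have -> : u k = (Num.sqrt c)%:C *: v k + 0.
  by rewrite addr0 /v scalerA -rmorphM /= divff ?scale1r// gt_eqF// sqrtr_gt0.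
exact: DD.
Qed.

Let basis : orthonormal_basis ip (range v).
Proof.
split.
  move=> _ _ [k _ <-] [l _ <-]; rewrite v_orth; congr (nat_of_bool _)%:R.
  by apply/idP/idP => [/eqP -> //|/eqP/v_inj ->].
move=> x xv; have ux y : ip y x = ip y 0.
  (* The form [ip y x = ip y 0], instead of [ip y x = 0], is an instance of [closed_ip_eq] with [F]
     the identity. *)
  apply: (v_total (D := [set y | ip y x = ip y 0])).
  - by apply: (@closed_ip_eq _ _ ip id) => // z; exact: cvg_id.
  - by rewrite /= !(ip0l ipP).
  - by move=> a w z /=; rewrite !(ipDl ipP) !(ipZl ipP) => -> ->.
  by move=> k /=; rewrite (ipC ipP) xv ?conjc0 ?(ip0r ipP)//; exists k.
apply/eqP; rewrite -rnorm_eq0 -sqrf_eq0; apply/eqP/(@complexI R).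
by rewrite -(ip_rnorm ipP) ux (ip0r ipP).
Qed.

Let S_v t k : 0 <= t -> S t (v k) = (expR (- t * q k))%:C *: v k.
Proof.
move=> t0; have [/(_ t t0)[Sl _] _ _ _] := CS.
rewrite /v (linear_mapZ _ _ Sl) (C0_semigroup_eigenvector CS (q_ge0 k) (@u_gen k))//.
by rewrite !scalerA mulrC.
Qed.

(** Totality of [v] is applied once in each argument, the second time after conjugation. On the
    family itself both sides vanish off the diagonal and agree on it, the eigenvalues being real. *)
Let S_sym t x y : 0 <= t -> ip (S t x) y = ip x (S t y).
Proof.
move=> t0; have [/(_ t t0)[Sl Sc] _ _ _] := CS.
have sym z : (forall k, ip (S t (v k)) z = ip (v k) (S t z)) ->
    forall w, ip (S t w) z = ip w (S t z).
  move=> hz; apply: v_total.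
  - exact: closed_ip_eq.
  - by rewrite (linear_map0 Sl) !(ip0l ipP).
  - by move=> a w w'; rewrite Sl !(ipDl ipP) !(ipZl ipP) => -> ->.
  - exact: hz.
apply: (sym) => k; rewrite (ipC ipP) [RHS](ipC ipP); congr conjc.
apply/esym/sym => l; rewrite !S_v// (ipZl ipP _ (v l)) (ipZr ipP _ (v k)) conjc_real.
rewrite v_orth.
by case: eqVneq => [->//|_]; rewrite !mulr0.
Qed.

Let S_half t x : 0 <= t -> ip (S t x) x = (rnorm (S (t / 2) x) ^+ 2)%:C.
Proof.
move=> t0; have t20 : 0 <= t / 2 by rewrite divr_ge0.
have [_ _ SD _] := CS.
by rewrite {1}[t]splitr SD// S_sym// (ip_rnorm ipP).
Qed.

Let rnorm_S_v t k : 0 <= t -> rnorm (S (t / 2) (v k)) ^+ 2 = expR (- t * q k).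
Proof.
move=> t0; apply/complexI; rewrite -S_half// S_v// (ipZl ipP _ (v k)) v_orth eqxx.
by rewrite mulr1.
Qed.

Let esum_S t (E : set H) : 0 <= t -> orthonormal_basis ip E ->
  (\esum_(e in E) (rnorm (S (t / 2) e) ^+ 2)%:E =
   \esum_(k in [set: I]) (expR (- t * q k))%:E)%E.
Proof.
move=> t0 bE; have sym x y : ip (S (t / 2) x) y = ip x (S (t / 2) y).
  by rewrite S_sym// divr_ge0.
rewrite (hilbert_schmidt_sum ipP bE basis sym) esum_image; last by move=> k l _ _ /v_inj.
by apply: eq_esum => k _; rewrite rnorm_S_v.
Qed.

Lemma diagonal_semigroup_trace t : 0 <= t ->
  (\esum_(k in [set: I]) (expR (- t * q k))%:E < +oo)%E ->
  trace_class ip (S t) /\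
  trace ip (S t) = (fine (\esum_(k in [set: I]) (expR (- t * q k))%:E)%E)%:C.
Proof.
move=> t0 fin; have [/(_ t t0)[Sl Sc] _ _ _] := CS.
have ipS : (fun e => ip (S t e) e) = fun e => (rnorm (S (t / 2) e) ^+ 2)%:C.
  by apply/funext => e; rewrite S_half.
split.
  (* [S t] is positive, hence its own absolute value. *)
  split => //; exists (S t), (range v); split; first split => //.
  - by move=> x; rewrite S_half// ler0c sqr_ge0.
  - exact: basis.
  - by rewrite ipS abs_summable_nonneg ?esum_S//; move=> x; rewrite sqr_ge0.
(* Uniqueness of the value rests on the existence of a basis: otherwise every number would qualify
   as [trace]. *)
apply: xget_subset1 => [E bE|z z' hz hz'].
  by rewrite ipS csum_nonneg ?esum_S// => x; rewrite sqr_ge0.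
by rewrite -(hz _ basis) -(hz' _ basis).
Qed.

End DiagonalSemigroup.

(** * Gaussian sums over the lattice *)

Lemma le_esumZ {R : realType} {I : choiceType} (D : set I) (c : R) (f : I -> \bar R) :
  0 <= c -> (forall i, (0 <= f i)%E) ->
  (\esum_(i in D) (c%:E * f i) <= c%:E * \esum_(i in D) f i)%E.
Proof.
move=> c0 f0; apply: ub_ereal_sup => _ [X [fX XD] <-].
rewrite -ge0_mule_fsumr// lee_wpmul2l// ?lee_fin//.
by apply: esum_ge; exists X.
Qed.

Lemma esum_geometric_lty {R : realType} (z : R) : 0 <= z -> z < 1 ->
  (\esum_(n in [set: nat]) (z ^+ n)%:E < +oo)%E.
Proof.
move=> z0 z1; rewrite -nneseries_esumT => [|n]; last by rewrite lee_fin exprn_ge0.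
apply: (@le_lt_trans _ _ ((1 - z)^-1)%:E); last exact: ltry.
apply: lime_le.
  by apply: is_cvg_nneseries => n _ _; rewrite lee_fin exprn_ge0.
apply: nearW => n; rewrite sumEFin lee_fin.
rewrite -[leRHS]mul1r ler_pdivlMr ?subr_gt0//.
rewrite big_mkord mulrC -opprB mulNr -subrX1 opprB lerBlDr lerDl exprn_ge0//.
Qed.

(** On the halves [n] and [-(n+1)] of the integers the square is at least [n], so the geometric
    series of ratio [exp (- t)] dominates. *)
Lemma esum_gauss_int_lty {R : realType} (t : R) : 0 < t ->
  (\esum_(a in [set: int]) (expR (- t * a%:~R ^+ 2))%:E < +oo)%E.
Proof.
move=> t0; have z1 : expR (- t) < 1 by rewrite expR_lt1 oppr_lt0.
have bnd (g : nat -> int) : injective g -> (forall n, n%:R <= (g n)%:~R ^+ 2 :> R) ->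
    (\esum_(a in range g) (expR (- t * a%:~R ^+ 2))%:E < +oo)%E.
  move=> gi gn; rewrite esum_image => [|a b _ _ /gi//].
  apply: le_lt_trans (esum_geometric_lty (expR_ge0 (- t)) z1).
  apply: le_esum => n _; rewrite lee_fin -expRM_natl ler_expR mulrC.
  by rewrite !mulrN lerN2 ler_wpM2r// ltW.
rewrite (esumID (range Posz)); last by move=> a _; rewrite lee_fin expR_ge0.
rewrite !setTI; have -> : ~` range Posz = range Negz.
  apply/seteqP; split => [[n|n] h|_ [n _ <-] []//]; last by exists n.
  by exfalso; apply: h; exists n.
apply: lte_add_pinfty; apply: bnd.
- by move=> m n [].
- by move=> n; rewrite -natrX ler_nat; case: n => // n; rewrite expnS expn1 leq_pmulr.
- by move=> m n [].
- move=> n; rewrite NegzE mulrNz sqrrN -natrX ler_nat.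
  by rewrite expnS expn1 (leq_trans (leqnSn n))// leq_pmulr.
Qed.

(** The Gaussian factorises over the coordinates, so splitting off the first one bounds the sum by a
    product of sums in dimensions 1 and [N]. *)
Lemma esum_gauss_lty {R : realType} (N : nat) (t : R) : 0 < t ->
  (\esum_(k in [set: 'rV[int]_N]) (expR (- t * sqnorm k))%:E < +oo)%E.
Proof.
move=> t0; elim: N => [|N IH].
  have -> : [set: 'rV[int]_0] = [set 0].
    by apply/seteqP; split => // k _; apply/rowP => -[].
  by rewrite esum_set1 ?ltry// lee_fin expR_ge0.
rewrite (@reindex_esum _ _ _ ([set: int] `*` [set: 'rV[int]_N]) _
    (fun ak => row_mx (ak.1%:M : 'rV_1) ak.2 : 'rV_(1 + N))); last first.
  split => //.
  - move=> [a k] [b l] _ _ /= /eq_row_mx[/matrixP/(_ 0 0)]; rewrite !mxE eqxx !mulr1n.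
    by move=> -> ->.
  - move=> k _; exists ((lsubmx (k : 'rV_(1 + N))) 0 0, rsubmx (k : 'rV_(1 + N))) => //=.
    by rewrite -[RHS](hsubmxK (k : 'rV_(1 + N))); congr row_mx; rewrite -mx11_scalar.
rewrite -[_ `*` _]/([set: int] `*`` (fun=> [set: 'rV[int]_N])).
have sqnormE (a : int) (k : 'rV[int]_N) :
    sqnorm (row_mx (a%:M : 'rV_1) k : 'rV_(1 + N)) = a%:~R ^+ 2 + sqnorm k :> R.
  rewrite /sqnorm big_split_ord big_ord1 row_mxEl mxE eqxx mulr1n; congr (_ + _).
  by apply: eq_bigr => i _; rewrite row_mxEr.
under eq_esum do rewrite sqnormE.
rewrite -(@esum_esum _ _ _ _ _
  (fun a k => (expR (- t * (a%:~R ^+ 2 + sqnorm k)))%:E)); last first.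
  by move=> a k _ _; rewrite lee_fin expR_ge0.
pose G := (\esum_(k in [set: 'rV[int]_N]) (expR (- t * sqnorm k))%:E)%E.
have G0 : (0 <= G)%E by apply: esum_ge0 => k _; rewrite lee_fin expR_ge0.
have GE : G = (fine G)%:E by rewrite fineK// ge0_fin_numE.
apply: (@le_lt_trans _ _ (\esum_(a in [set: int])
  ((fine G)%:E * (expR (- t * a%:~R ^+ 2))%:E)))%E.
  apply: le_esum => a _; rewrite -GE muleC.
  under eq_esum do rewrite mulrDr expRD EFinM.
  by apply: le_esumZ => [|k]; rewrite ?lee_fin expR_ge0.
apply: le_lt_trans (le_esumZ _ _ _) _; [exact: fine_ge0| |].
  by move=> a; rewrite lee_fin expR_ge0.
by rewrite -GE GE lte_mul_pinfty ?lee_fin ?fine_ge0// esum_gauss_int_lty.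
Qed.

(** * Characters of the torus *)

Section Cis.
Context {R : realType}.
Implicit Types x y : R.

Lemma cisD x y : cis (x + y) = cis x * cis y.
Proof. by rewrite /cis cosD sinD; simpc; congr (_ +i* _); rewrite addrC. Qed.

Lemma cis0 : cis (0 : R) = 1.
Proof. by rewrite /cis cos0 sin0. Qed.

Lemma cisN x : cis (- x) = conjc (cis x).
Proof. by rewrite /cis cosN sinN. Qed.

Lemma cis2pi_int (z : int) : cis (2 * pi * z%:~R : R) = 1.
Proof.
have h n : cis (2 * pi * n%:R : R) = 1.
  elim: n => [|n IH]; first by rewrite mulr0 cis0.
  rewrite -(natr1 n) mulrDr mulr1 cisD IH mul1r /cis mulr_natl.
  by rewrite cos2pi sin2pi.
case: z => n; first exact: h.
by rewrite NegzE mulrNz mulrN cisN h conjc1.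
Qed.

Lemma cisD2pi x (z : int) : cis (x + 2 * pi * z%:~R) = cis x.
Proof. by rewrite cisD cis2pi_int mulr1. Qed.

Lemma cosD2pi_int x (z : int) : cos (x + 2 * pi * z%:~R) = cos x.
Proof. by have := cisD2pi x z => -[]. Qed.

Lemma sinD2pi_int x (z : int) : sin (x + 2 * pi * z%:~R) = sin x.
Proof. by have := cisD2pi x z => -[]. Qed.

End Cis.

Lemma continuous_addf {R : realType} {T : topologicalType} (f g : T -> R) :
  continuous f -> continuous g -> continuous (fun x => f x + g x).
Proof. by move=> cf cg x; exact: (cvgD (cf x) (cg x)). Qed.

Lemma continuous_mulf {R : realType} {T : topologicalType} (f g : T -> R) :
  continuous f -> continuous g -> continuous (fun x => f x * g x).
Proof. by move=> cf cg x; exact: (cvgM (cf x) (cg x)). Qed.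

Section Characters.
Context {R : realType} {N : nat}.
Implicit Types (k l m : 'rV[int]_N) (x : 'rV[R]_N) (a c : R).

Definition dotz k x : R := \sum_(i < N) (k 0 i)%:~R * x 0 i.

Definition character k x : R[i] := cis (dotz k x).

(** A family stable under partial derivatives, which multiply the amplitude by [k_i] and advance the
    phase by [pi / 2]. It contains the real and imaginary parts of the characters, with phases [0]
    and [- pi / 2], so one induction settles smoothness. *)
Definition coswave c a k x : R := c * cos (a + dotz k x).

Lemma dotzDl k l x : dotz (k + l) x = dotz k x + dotz l x.
Proof.
by rewrite -big_split; apply: eq_bigr => i _; rewrite !mxE rmorphD mulrDl.
Qed.

Lemma dotzN k x : dotz (- k) x = - dotz k x.
Proof. by rewrite -sumrN; apply: eq_bigr => i _; rewrite !mxE rmorphN mulNr. Qed.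

Lemma dotzDr k x y : dotz k (x + y) = dotz k x + dotz k y.
Proof. by rewrite -big_split; apply: eq_bigr => i _; rewrite !mxE mulrDr. Qed.

Lemma dotz_delta k c i : dotz k (c *: delta_mx 0 i) = (k 0 i)%:~R * c.
Proof.
rewrite /dotz (bigD1 i)//= !mxE !eqxx mulr1 big1 ?addr0// => j ji.
by rewrite !mxE (negPf ji) andbF !mulr0.
Qed.

Lemma dotz_continuous k : continuous (dotz k).
Proof.
rewrite /dotz; elim: (index_enum _) => [|i s IH].
  rewrite (_ : (fun _ => _) = fun=> 0); first by move=> x; exact: cst_continuous.
  by apply/funext => y; rewrite big_nil.
rewrite (_ : (fun _ => _) = fun y : 'rV[R]_N =>
    (k 0 i)%:~R * y 0 i + \sum_(j <- s) (k 0 j)%:~R * y 0 j); last first.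
  by apply/funext => y; rewrite big_cons.
apply: continuous_addf => //; apply: continuous_mulf => x.
  exact: cst_continuous.
exact: coord_continuous.
Qed.

Lemma coswave_continuous c a k : continuous (coswave c a k).
Proof.
apply: continuous_mulf => [x|x]; first exact: cst_continuous.
apply: continuous_comp; last exact: continuous_cos.
by apply: continuous_addf => y; [exact: cst_continuous|exact: dotz_continuous].
Qed.

Lemma is_derive_coswave c a k x i :
  is_derive x (delta_mx 0 i) (coswave c a k)
    (coswave (c * (k 0 i)%:~R) (a + pi / 2) k x).
Proof.
pose phi (h : R) := c * cos (a + dotz k x + (k 0 i)%:~R * h).
have [phid phiE] : is_derive (0 : R) 1 phi
    (coswave (c * (k 0 i)%:~R) (a + pi / 2) k x).
  have gd : is_derive (0 : R) 1 (fun h : R => a + dotz k x + (k 0 i)%:~R * h) (k 0 i)%:~R.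
    by apply: is_derive_eq; rewrite add0r mul1r /GRing.scale /= mulr1.
  have cd := is_derive1_comp (is_derive_cos _) gd.
  apply: is_derive_eq.
  rewrite /coswave mulr0 addr0 [a + _ + dotz _ _]addrAC cosDpihalf.
  by rewrite /GRing.scale /=; ring.
have E : (fun h : R => h^-1 *:
      ((coswave c a k \o shift x) (h *: delta_mx 0 i) - coswave c a k x))
    = fun h => h^-1 *: ((phi \o shift 0) (h *: 1) - phi 0).
  apply/funext => h; rewrite /= /phi /coswave dotzDr dotz_delta mulr0 addr0.
  rewrite /GRing.scale /= mulr1 addr0.
  by congr (_ * (_ * cos _ - _)); rewrite addrA addrAC.
by split; rewrite /derivable /derive E.
Qed.

Lemma coswave_Ck n c a k : Ck n (coswave c a k).
Proof.
elim: n c a => [|n IH] c a; split => //; try exact: coswave_continuous.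
split => [i x|i]; first by case: (is_derive_coswave c a k x i).
rewrite (_ : partial i _ = coswave (c * (k 0 i)%:~R) (a + pi / 2) k)//.
by apply/funext => x; case: (is_derive_coswave c a k x i).
Qed.

Lemma partial2_coswave c a k i x :
  partial i (partial i (coswave c a k)) x = - ((k 0 i)%:~R ^+ 2) * coswave c a k x.
Proof.
have pE c' a' : partial i (coswave c' a' k) = coswave (c' * (k 0 i)%:~R) (a' + pi / 2) k.
  by apply/funext => y; case: (is_derive_coswave c' a' k y i).
rewrite !pE /coswave -[a + pi / 2 + pi / 2 + _]addrA -!addrA.
rewrite (addrC (pi / 2) (dotz _ _)) !addrA !cosDpihalf.
rewrite (_ : sin _ = cos (a + dotz k x)); first by ring.
by rewrite addrAC sinDpihalf.
Qed.

Lemma characterD k l x : character (k + l) x = character k x * character l x.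
Proof. by rewrite /character dotzDl cisD. Qed.

Lemma characterN k x : character (- k) x = conjc (character k x).
Proof. by rewrite /character dotzN cisN. Qed.

Lemma character_periodic k : Defs.periodic (character k).
Proof.
move=> x m; rewrite /character dotzDr.
have -> : dotz k ((2 * pi) *: map_mx intr m) = 2 * pi * (\sum_i k 0 i * m 0 i)%:~R.
  rewrite rmorph_sum mulr_sumr; apply: eq_bigr => i _ /=.
  by rewrite !mxE rmorphM mulrCA.
exact: cisD2pi.
Qed.

Lemma re_character k : re_part (character k) = coswave 1 0 k.
Proof. by apply/funext => x; rewrite /coswave mul1r add0r. Qed.

Lemma im_character k : im_part (character k) = coswave 1 (- (pi / 2)) k.
Proof. by apply/funext => x; rewrite /coswave mul1r addrC cosBpihalf. Qed.

Lemma character_smooth k : torus_smooth (character k).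
Proof.
split; first exact: character_periodic.
by move=> n; rewrite re_character im_character; split; exact: coswave_Ck.
Qed.

Lemma character_torus_continuous k : torus_continuous (character k).
Proof.
split; first exact: character_periodic.
  by rewrite re_character; exact: coswave_continuous.
by rewrite im_character; exact: coswave_continuous.
Qed.

Lemma laplacian_character k :
  laplacian (character k) = fun x => (- sqnorm k)%:C * character k x.
Proof.
apply/funext => x; rewrite /laplacian re_character im_character.
under eq_bigr do rewrite partial2_coswave.
under [X in _ +i* X]eq_bigr do rewrite partial2_coswave.
rewrite -!mulr_suml -re_character -im_character sumrN /re_part /im_part.
by rewrite -/(sqnorm k); case: (character k x) => u v; simpc.
Qed.

Lemma character_conj k l x : character k x * conjc (character l x) = character (k - l) x.
Proof. by rewrite characterD characterN. Qed.

End Characters.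

(** * Integrals over the fundamental cube *)

Lemma pi2_gt0 {R : realType} : 0 < 2 * pi :> R.
Proof. by rewrite mulr_gt0// pi_gt0. Qed.

Lemma continuous_cos_affine {R : realType} (b c : R) :
  continuous (fun x : R => cos (b + c * x)).
Proof.
move=> x; apply: (@continuous_comp _ _ _ (fun x : R => b + c * x) cos).
  apply: continuous_addf => [y|y]; first exact: cst_continuous.
  by apply: continuous_mulf => z; [exact: cst_continuous|exact: cvg_id].
exact: continuous_cos.
Qed.

Lemma Rintegral_cos {R : realType} (b : R) (m : int) :
  \int[lebesgue_measure]_(x in `[0, 2 * pi]) cos (b + m%:~R * x) =
  if m == 0 then 2 * pi * cos b else 0.
Proof.
case: eqVneq => [->|m0].
  under eq_Rintegral do rewrite mul0r addr0.
  rewrite Rintegral_cst//= lebesgue_measure_itv/= lte_fin pi2_gt0 oppr0 adde0/=.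
  by rewrite mulrC.
pose F (x : R) := (m%:~R)^-1 * sin (b + m%:~R * x).
have mR : m%:~R != 0 :> R by rewrite intr_eq0.
have Fd (x : R) : is_derive x 1 F (cos (b + m%:~R * x)).
  have gd : is_derive x 1 (fun h : R => b + m%:~R * h) m%:~R.
    by apply: is_derive_eq; rewrite add0r mul1r /GRing.scale /= mulr1.
  have cd := is_derive1_comp (is_derive_sin _) gd.
  apply: is_derive_eq; rewrite /GRing.scale /= mulrC mulfK//.
have Fc : continuous F.
  move=> x; apply/differentiable_continuous/derivable1_diffP.
  by have [] := Fd x.
rewrite /Rintegral (@continuous_FTC2 _ _ F)//=.
- by rewrite /F (mulrC m%:~R (2 * pi)) sinD2pi_int mulr0 addr0 subrr.
- exact: pi2_gt0.
- apply: continuous_subspaceT; exact: continuous_cos_affine.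
- split => [x _||]; first by case: (Fd x).
    exact/cvg_at_right_filter/Fc.
  exact/cvg_at_left_filter/Fc.
- by move=> x _; rewrite derive1E; case: (Fd x).
Qed.

(** The phase [b] is arbitrary because the contribution of the outer coordinate to [k . x] is
    absorbed into the phase of the inner integral. *)
Lemma cube_integral_cos {R : realType} (N : nat) (b : R) (k : 'rV[int]_N) :
  cube_integral (fun x : 'rV[R]_N => cos (b + dotz k x)) =
  if k == 0 then (2 * pi) ^+ N * cos b else 0.
Proof.
elim: N b k => [|N IH] b k.
  rewrite /= /dotz big_ord0 addr0 expr0 mul1r.
  by rewrite (_ : k == 0) //; apply/eqP/rowP => -[].
pose k' : 'rV[int]_(1 + N) := k.
have dotE (a : R) (y : 'rV[R]_N) :
    dotz k (row_mx (a%:M : 'rV_1) y : 'rV_(1 + N)) = (k 0 0)%:~R * a + dotz (rsubmx k') y.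
  rewrite /dotz (@big_split_ord _ _ _ 1 N) big_ord1.
  congr (_%:~R * _ + _); first by congr (k 0 _); exact/val_inj.
    by apply: (etrans (row_mxEl _ _ _ _)); rewrite mxE eqxx.
  by apply: eq_bigr => i _; congr (_%:~R * _); [rewrite mxE|exact: row_mxEr].
have k0E : (k == 0) = (k 0 0 == 0) && (rsubmx k' == 0).
  apply/eqP/andP => [k0|[/eqP k0 /eqP kr]].
    rewrite /k' k0 mxE eqxx; split => //; apply/eqP/rowP => i; rewrite !mxE.
    by [].
  have : k' = 0; last by [].
  rewrite -[k']hsubmxK kr (_ : lsubmx k' = 0) ?row_mx0//.
  apply/rowP => i; rewrite ord1 !mxE -[RHS]k0; congr (k 0 _); exact/val_inj.
rewrite [LHS]/=; under eq_Rintegral => a _.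
  under [X in cube_integral X]eq_fun do rewrite dotE addrA.
  rewrite IH; over.
rewrite k0E; case: (rsubmx k' == 0); last by rewrite Rintegral_cst// mul0r andbF.
rewrite RintegralZl//; last first.
  apply: continuous_compact_integrable; first exact: segment_compact.
  apply: continuous_subspaceT; exact: continuous_cos_affine.
rewrite Rintegral_cos andbT exprSr -mulrA.
by case: ifP => _; rewrite ?mulr0// !mulrA.
Qed.

Lemma torus_integral_character {R : realType} (N : nat) (k : 'rV[int]_N) :
  torus_integral (character k : 'rV[R]_N -> R[i]) = ((2 * pi) ^+ N *+ (k == 0))%:C.
Proof.
rewrite /torus_integral re_character im_character /coswave.
under [X in cube_integral X]eq_fun do rewrite mul1r.
under [X in _ +i* cube_integral X]eq_fun do rewrite mul1r.
rewrite !cube_integral_cos cosN cos_pihalf cos0 mulr0 mulr1.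
by case: (k == 0).
Qed.

(** No measurability is assumed: the integral of a nonnegative function is a supremum over the
    simple functions below it, hence monotone. The bound can thus be iterated whatever the
    dependence of the inner integrals on the outer variable. *)
Lemma Rintegral_le_bound {R : realType} (f : R -> R) (M : R) :
  (forall x, 0 <= f x <= M) ->
  0 <= \int[lebesgue_measure]_(x in `[0, 2 * pi]) f x <= 2 * pi * M.
Proof.
move=> fM; have f0 x : 0 <= f x by case/andP: (fM x).
have M0 : 0 <= M by case/andP: (fM 0) => /le_trans h /h.
pose D : set R := [set` `[0, 2 * pi]].
rewrite Rintegral_ge0//=.
have -> : 2 * pi * M = \int[lebesgue_measure]_(x in `[0, 2 * pi]) (cst M) x.
  rewrite Rintegral_cst//= lebesgue_measure_itv/= lte_fin pi2_gt0 oppr0 adde0/=.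
  by rewrite mulrC.
have fin : (\int[lebesgue_measure]_(x in D) M%:E < +oo)%E.
  by rewrite /D integral_cst//= lebesgue_measure_itv/= lte_fin pi2_gt0 -EFinB -EFinM ltry.
have le : (\int[lebesgue_measure]_(x in D) (f x)%:E <=
    \int[lebesgue_measure]_(x in D) M%:E)%E.
  rewrite !ge0_integralE//; try by move=> x _; rewrite lee_fin.
  apply: le_ereal_sup => _ [h hf <-]; exists h => //= x.
  apply: (le_trans (hf x)); rewrite /patch; case: ifP => //= _.
  by rewrite lee_fin; case/andP: (fM x).
have i0 : (0 <= \int[lebesgue_measure]_(x in D) (f x)%:E)%E.
  by apply: integral_ge0 => x _; rewrite lee_fin.
rewrite /Rintegral fine_le// ge0_fin_numE//; first exact: le_lt_trans le fin.
exact: le_trans i0 le.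
Qed.

Lemma cube_integral_le_bound {R : realType} (N : nat) (f : 'rV[R]_N -> R) (M : R) :
  (forall x, 0 <= f x <= M) -> 0 <= cube_integral f <= (2 * pi) ^+ N * M.
Proof.
elim: N f => [|N IH] f fM; first by rewrite expr0 mul1r; exact: fM.
rewrite exprS -mulrA; apply: Rintegral_le_bound => x; apply: IH => y; exact: fM.
Qed.

(** * Fejer kernels *)

Section FejerKernel.
Context {R : realType}.
Implicit Types (v a : R) (m : nat).

Lemma cisMn v n : cis (n%:R * v) = cis v ^+ n.
Proof.
elim: n => [|n IH]; first by rewrite mul0r expr0 cis0.
by rewrite -(natr1 n) mulrDl mul1r cisD IH exprSr.
Qed.

Lemma cis_neq1 v : 0 < v -> v < 2 * pi -> cis v != 1.
Proof.
move=> v0 vpi; apply/eqP => -[c1 _].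
have : 0 < sin (v / 2) by apply: sin_gt0_pi; apply/andP; split; lra.
have h : cos v = 1 - 2 * sin (v / 2) ^+ 2.
  by rewrite {1}[v]splitr cosD -!expr2 cos2sin2; ring.
move=> s0; have : 0 < sin (v / 2) ^+ 2 by rewrite exprn_gt0.
lra.
Qed.

(** For [p != q] this is a geometric sum of ratio [z] with [z^m = 1], and [z != 1] because
    [0 < |p - q| < m]. *)
Lemma sum_roots_of_unity m (p q : 'I_m) :
  \sum_(j < m) cis ((p%:R - q%:R) * (2 * pi * j%:R / m%:R) : R) =
  (m%:R * (p == q)%:R : R)%:C.
Proof.
have m0 : (0 < m)%N by apply: leq_ltn_trans (ltn_ord p).
have mR : m%:R != 0 :> R by rewrite pnatr_eq0 -lt0n.
pose z := cis ((p%:R - q%:R) * (2 * pi / m%:R) : R).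
have jE (j : 'I_m) : cis ((p%:R - q%:R) * (2 * pi * j%:R / m%:R) : R) = z ^+ j.
  by rewrite -cisMn; congr cis; ring.
under eq_bigr do rewrite jE.
case: eqVneq => [pq|pq].
  rewrite mulr1 /z pq subrr mul0r cis0; under eq_bigr do rewrite expr1n.
  by rewrite sumr_const card_ord rmorph_nat.
rewrite mulr0; have zm : z ^+ m = 1.
  rewrite -cisMn (_ : _ * _ = 2 * pi * (p%:Z - q%:Z)%:~R) ?cis2pi_int//.
  by rewrite rmorphB /= -!pmulrn; field.
have wlogz (r s : 'I_m) : (r < s)%N -> cis ((s%:R - r%:R) * (2 * pi / m%:R) : R) != 1.
  move=> rs; have rsR : r%:R < s%:R :> R by rewrite ltr_nat.
  have mR0 : 0 < m%:R :> R by rewrite ltr0n.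
  apply: cis_neq1; first by rewrite mulr_gt0 ?subr_gt0// divr_gt0// pi2_gt0.
  rewrite mulrA ltr_pdivrMr// mulrC ltr_pM2l ?pi2_gt0//.
  rewrite ltrBlDr -natrD ltr_nat; exact: (leq_trans (ltn_ord s) (leq_addr _ _)).
have z1 : z != 1.
  case: (ltngtP p q) pq => [pq _|qp _|/val_inj -> /eqP//]; last exact: wlogz.
  apply: contraNneq (wlogz _ _ pq) => z1.
  by rewrite -opprB mulNr cisN -/z z1 conjc1.
have := subrX1 z m; rewrite zm subrr => /esym/eqP.
by rewrite mulf_eq0 subr_eq0 (negPf z1) => /eqP.
Qed.

(** Away from the zeros of [sin (v / 2)] this is [(sin (m v / 2) / (m sin (v / 2)))^2]: the Fejer
    kernel scaled to the value 1 at 0, so that its translates over the grid of [m] points sum to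
    1. *)
Definition fejer m v : R := cabs (\sum_(l < m) cis (l%:R * v)) ^+ 2 / m%:R ^+ 2.

Lemma fejer_ge0 m v : 0 <= fejer m v.
Proof. by rewrite divr_ge0 ?sqr_ge0. Qed.

Lemma fejerE m v : (fejer m v)%:C =
  \sum_(pq : 'I_m * 'I_m) ((m%:R ^+ 2)^-1)%:C * cis ((pq.1%:R - pq.2%:R) * v).
Proof.
rewrite rmorphM /= sqr_cabs mulrC -mulr_sumr; congr (_ * _).
rewrite -(pair_bigA _ (fun p q : 'I_m => cis ((p%:R - q%:R) * v))) /=.
rewrite rmorph_sum mulr_suml; apply: eq_bigr => p _.
rewrite mulr_sumr; apply: eq_bigr => q _.
by rewrite mulrBl cisD cisN.
Qed.

(** Summing over the grid keeps only the [m] diagonal terms of the squared Dirichlet sum, each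
    contributing [m / m^2]. *)
Lemma sum_fejer m v : (0 < m)%N ->
  \sum_(j < m) fejer m (v - 2 * pi * j%:R / m%:R) = 1.
Proof.
move=> m0; have mR : m%:R != 0 :> R by rewrite pnatr_eq0 -lt0n.
apply/complexI; rewrite rmorph_sum /=; under eq_bigr do rewrite fejerE.
rewrite exchange_big /=.
transitivity (\sum_(pq : 'I_m * 'I_m)
    ((m%:R ^+ 2)^-1 * (m%:R * (pq.2 == pq.1)%:R) : R)%:C).
  apply: eq_bigr => -[p q] _ /=; rewrite -mulr_sumr rmorphM /=; congr (_ * _).
  case: eqVneq => [->|qp].
    rewrite subrr; under eq_bigr do rewrite mul0r cis0.
    by rewrite sumr_const card_ord mulr1 rmorph_nat.
  transitivity (cis ((p%:R - q%:R) * v) *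
     \sum_(j < m) cis ((q%:R - p%:R) * (2 * pi * j%:R / m%:R) : R)).
    rewrite mulr_sumr; apply: eq_bigr => j _; rewrite -cisD; congr cis; ring.
  by rewrite sum_roots_of_unity (negPf qp) mulr0 mulr0.
rewrite -rmorph_sum -mulr_sumr /=; congr (_%:C).
rewrite -(pair_bigA _ (fun p q : 'I_m => m%:R * (q == p)%:R)) /=.
rewrite (eq_bigr (fun=> m%:R)) => [|p _].
  by rewrite sumr_const card_ord -(mulr_natr m%:R) -expr2 mulVf ?expf_neq0.
rewrite (bigD1 p)//= eqxx mulr1 big1 ?addr0// => q /negPf ->; rewrite mulr0//.
Qed.

Lemma sqr_cabs_1Bcis v : cabs (1 - cis v) ^+ 2 = 2 * (1 - cos v).
Proof.
rewrite cabs_sqrt sqr_sqrtr ?addr_ge0 ?sqr_ge0//= add0r sqrrN.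
by have := cos2Dsin2 v; lra.
Qed.

(* (1 - e^{iv}) D(v) = 1 - e^{imv} for the Dirichlet sum D. *)
Lemma fejer_1Bcos m v : fejer m v * (1 - cos v) <= 2 / m%:R ^+ 2.
Proof.
rewrite /fejer mulrAC ler_wpM2r ?invr_ge0 ?sqr_ge0//.
have -> : 1 - cos v = cabs (1 - cis v) ^+ 2 / 2.
  by rewrite sqr_cabs_1Bcis mulrC mulKf.
rewrite mulrA -exprMn -cabsM mulrC.
under eq_bigr do rewrite cisMn.
rewrite (mulrC (\sum_i _)) -opprB mulNr -subrX1 opprB -cisMn sqr_cabs_1Bcis.
by have := cos_geN1 (m%:R * v); lra.
Qed.

End FejerKernel.

(** * Moduli of continuity on the torus *)

(** Only [x] is confined to [K]: when periodicity is used to move a second point close to [x], it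
    may leave [K]. *)
Lemma continuous_uniform_on_compact {R : realType} {N : nat} (g : 'rV[R]_N -> R)
    (K : set 'rV[R]_N) (e : R) : continuous g -> compact K -> 0 < e ->
  exists2 d : R, 0 < d & forall x y : 'rV[R]_N, K x ->
    (forall i, `|x 0 i - y 0 i| < d) -> `|g x - g y| < e.
Proof.
move=> gc /compact_near_coveringP Kc e0.
have := Kc _ (0^'+ : set_system R) (fun (d : R) (x : 'rV[R]_N) => forall y : 'rV[R]_N,
  (forall i, `|x 0 i - y 0 i| < d) -> `|g x - g y| < e) _.
case=> [x Kx|d /= d0 dP]; last first.
  exists (d / 2); first by rewrite divr_gt0.
  move=> x y Kx; apply: (dP (d / 2)) => //=; last by rewrite divr_gt0.
  by rewrite sub0r normrN gtr0_norm ?divr_gt0//; lra.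
have /cvgrPdist_lt/(_ (e / 2)) := gc x; rewrite divr_gt0// => /(_ isT).
move=> /nbhs_ballP[r /= r0 rP].
have r2 : 0 < r / 2 by rewrite divr_gt0.
exists (ball x (r / 2), [set d | 0 < d < r / 2]) => /=.
  split; first exact: nbhsx_ballx.
  near=> d; apply/andP; split => //.
move=> [x' d] [/= xx' /andP[d0 dr]] y x'y.
have h1 : `|g x - g x'| < e / 2.
  apply: rP; apply: le_ball xx'; lra.
have h2 : `|g x - g y| < e / 2.
  apply: rP; split => // i j; have h : `|x i j - x' i j| < r / 2 := xx'.2 i j.
  have h3 : `|x' i j - y i j| < d by rewrite (ord1 i).
  rewrite /ball /= [ltRHS]splitr; apply: le_lt_trans (ler_distD (x' i j) _ _) _.
  by rewrite ltrD// (lt_trans h3).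
by have := ler_distD (g x) (g x') (g y); rewrite (distrC (g x') (g x)); lra.
Unshelve. all: end_near. Qed.

Lemma continuous_bounded_on_compact {R : realType} {N : nat} (g : 'rV[R]_N -> R)
    (K : set 'rV[R]_N) : continuous g -> compact K ->
  exists2 M : R, 0 <= M & forall x, K x -> `|g x| <= M.
Proof.
move=> gc Kc; have /compact_bounded[M [_ MP]] : compact (g @` K).
  by apply: continuous_compact => //; exact: continuous_subspaceT.
exists (`|M| + 1); first by rewrite addr_ge0.
move=> x Kx; apply: MP; last by exists x.
by rewrite (le_lt_trans (ler_norm _))// ltrDl.
Qed.

Lemma shift_to_period {R : realType} (a x : R) :
  exists z : int, a <= x + 2 * pi * z%:~R <= a + 2 * pi.
Proof.
have p0 := @pi2_gt0 R.
exists (- Num.floor ((x - a) / (2 * pi))); set z := Num.floor _.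
have z1 : z%:~R <= (x - a) / (2 * pi) by exact: floor_le.
have z2 : (x - a) / (2 * pi) < z%:~R + 1 by rewrite -intrD1; exact: floorD1_gt.
move: z1 z2; rewrite ler_pdivlMr// ltr_pdivrMr// rmorphN /= => z1 z2.
apply/andP; split; nra.
Qed.

Lemma cos_le_away {R : realType} (d u : R) : 0 < d -> d <= `|u| -> `|u| <= pi ->
  cos u <= cos d.
Proof.
move=> d0 du upi; have -> : cos u = cos `|u| by case: (ger0P u); rewrite ?cosN.
move: du; rewrite le_eqVlt => /orP[/eqP <-//|du]; apply: ltW.
by rewrite ltr_cos// in_itv/=; apply/andP; split; lra.
Qed.

(* A modulus of continuity that is a function on the torus. *)
Lemma periodic_modulus {R : realType} {N : nat} (g : 'rV[R]_N -> R) (e : R) :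
  continuous g -> (forall x k, g (x + (2 * pi) *: map_mx intr k) = g x) -> 0 < e ->
  exists2 C : R, 0 <= C & forall x y,
    `|g x - g y| <= e + C * \sum_(i < N) (1 - cos (x 0 i - y 0 i)).
Proof.
move=> gc gp e0; have p0 := @pi_gt0 R.
pose K : set 'rV[R]_N := [set v | forall i, `[0, 2 * pi]%classic (v ord0 i)].
have Kc : compact K.
  apply: (@rV_compact R N (fun=> `[0, 2 * pi]%classic)) => i.
  exact: segment_compact.
have shift (a : 'I_N -> R) (x : 'rV[R]_N) : exists k : 'rV[int]_N, forall i,
    a i <= (x + (2 * pi) *: map_mx intr k) 0 i <= a i + 2 * pi.
  have /choice[z zP] := fun i => shift_to_period (a i) (x 0 i).
  by exists (\row_i z i) => i; rewrite !mxE.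
have [d1 d10 gu] := continuous_uniform_on_compact gc Kc e0.
have [M M0 gM] := continuous_bounded_on_compact gc Kc.
have gM' x : `|g x| <= M.
  have [k kP] := shift (fun=> 0) x; rewrite -(gp x k); apply: gM => i /=.
  by have := kP i; rewrite in_itv/= add0r.
(* The cap at [pi] keeps [d] in the range where the cosine decreases. *)
pose d := Num.min d1 pi; have d0 : 0 < d by rewrite lt_min d10 p0.
have dpi : d <= pi by rewrite ge_min lexx orbT.
have cd : 0 < 1 - cos d.
  rewrite subr_gt0 -(@cos0 R) ltr_cos// in_itv/=; apply/andP; split=> //; exact: ltW.
exists (2 * M / (1 - cos d)) => [|x y]; first by rewrite divr_ge0 ?mulr_ge0// ltW.
(* [x] is moved into the basic cube and [y] into the cube of side [2 pi] centred at [x'], so that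
   coordinates differ by at most [pi]. *)
have [k kP] := shift (fun=> 0) x; set x' := x + _ in kP.
have [l lP] := shift (fun i => x' 0 i - pi) y; set y' := y + _ in lP.
have Kx' : K x' by move=> i /=; have := kP i; rewrite in_itv/= add0r.
have xy i : `|x' 0 i - y' 0 i| <= pi.
  by have := lP i; rewrite ler_norml => /andP[? ?]; apply/andP; split; lra.
have cosE i : cos (x 0 i - y 0 i) = cos (x' 0 i - y' 0 i).
  rewrite !mxE -(cosD2pi_int _ (k 0 i - l 0 i)); congr cos.
  by rewrite rmorphB /=; ring.
rewrite -(gp x k) -(gp y l) -/x' -/y'.
have S0 (P : pred 'I_N) : 0 <= \sum_(i < N | P i) (1 - cos (x 0 i - y 0 i)).
  by apply: sumr_ge0 => i _; rewrite subr_ge0 cos_le1.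
have C0 : 0 <= 2 * M / (1 - cos d) by rewrite divr_ge0 ?mulr_ge0// ltW.
have [all|/existsNP[i /negP]] := pselect (forall i, `|x' 0 i - y' 0 i| < d).
  rewrite (le_trans (ltW (gu x' y' Kx' _)))// => [i|].
    by rewrite (lt_le_trans (all i))// ge_min lexx.
  by rewrite lerDl mulr_ge0.
rewrite -leNgt => di.
have ci : 1 - cos d <= 1 - cos (x 0 i - y 0 i).
  by rewrite lerD2l lerN2 cosE cos_le_away.
(* Far apart, the trivial bound [2 M] is paid for by the coordinate [i] alone, which contributes at
   least [1 - cos d]; hence the constant. *)
apply: (@le_trans _ _ (2 * M)).
  by have := ler_normB (g x') (g y'); have := gM' x'; have := gM' y'; lra.
rewrite (bigD1 i)//= ler_wpDl ?(ltW e0)//.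
rewrite -[leLHS](divfK (lt0r_neq0 cd)) ler_wpM2l//.
by apply: (le_trans ci); rewrite lerDl.
Qed.

Lemma cabs_le_ReIm {R : realType} (z : R[i]) :
  cabs z <= `|complex.Re z| + `|complex.Im z|.
Proof.
case: z => a b; rewrite cabs_sqrt /= -[leRHS]ger0_norm ?addr_ge0// -sqrtr_sqr.
apply: ler_wsqrtr.
rewrite sqrrD !real_normK ?num_real// addrAC lerDl mulrn_wge0// mulr_ge0//.
Qed.

Lemma torus_modulus {R : realType} {N : nat} (f : 'rV[R]_N -> R[i]) (e : R) :
  torus_continuous f -> 0 < e ->
  exists2 C : R, 0 <= C & forall x y,
    cabs (f x - f y) <= e + C * \sum_(i < N) (1 - cos (x 0 i - y 0 i)).
Proof.
move=> [fp rc ic] e0; have e20 : 0 < e / 2 by rewrite divr_gt0.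
have [x k|C C0 CP] := periodic_modulus rc _ e20; first by rewrite /re_part fp.
have [x k|D D0 DP] := periodic_modulus ic _ e20; first by rewrite /im_part fp.
exists (C + D) => [|x y]; first exact: addr_ge0.
apply: (le_trans (cabs_le_ReIm _)); rewrite !raddfB /=.
have := CP x y; have := DP x y; rewrite /re_part /im_part mulrDl; lra.
Qed.

(** * Totality of the characters *)

Section FejerMean.
Context {R : realType} {N : nat}.
Implicit Types (f g : 'rV[R]_N -> R[i]) (m : nat).

Definition grid_point m (J : {ffun 'I_N -> 'I_m}) : 'rV[R]_N :=
  \row_i (2 * pi * (J i)%:R / m%:R).

Definition fejer_weight m (J : {ffun 'I_N -> 'I_m}) (x : 'rV[R]_N) : R :=
  \prod_(i < N) fejer m (x 0 i - grid_point J 0 i).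

Definition fejer_mean m f (x : 'rV[R]_N) : R[i] :=
  \sum_(J : {ffun 'I_N -> 'I_m}) f (grid_point J) * (fejer_weight J x)%:C.

Lemma sum_fejer_weight m x : (0 < m)%N ->
  \sum_(J : {ffun 'I_N -> 'I_m}) fejer_weight J x = 1.
Proof.
move=> m0; rewrite /fejer_weight.
under eq_bigr do under eq_bigr do rewrite mxE.
rewrite -(bigA_distr_bigA (fun i (j : 'I_m) => fejer m (x 0 i - 2 * pi * j%:R / m%:R))).
by rewrite big1// => i _; exact: sum_fejer.
Qed.

(** In the product weight only the factor at [i] meets [1 - cos], giving [m] terms of size at most
    [2 / m^2]; the other factors sum to 1. *)
Lemma sum_fejer_weight_1Bcos m x i : (0 < m)%N ->
  \sum_(J : {ffun 'I_N -> 'I_m})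
    fejer_weight J x * (1 - cos (x 0 i - grid_point J 0 i)) <= 2 / m%:R.
Proof.
move=> m0; pose F l (j : 'I_m) := fejer m (x 0 l - 2 * pi * j%:R / m%:R) *
  (if l == i then 1 - cos (x 0 l - 2 * pi * j%:R / m%:R) else 1).
rewrite (eq_bigr (fun J : {ffun 'I_N -> 'I_m} => \prod_l F l (J l))); last first.
  move=> J _; rewrite big_split /=; congr (_ * _).
    by apply: eq_bigr => l _; rewrite mxE.
  by rewrite -big_mkcond big_pred1_eq mxE.
rewrite -(bigA_distr_bigA F) (bigD1 i)//= [X in _ * X]big1 ?mulr1; last first.
  move=> l li; rewrite /F (negPf li); under eq_bigr do rewrite mulr1.
  exact: sum_fejer.
rewrite /F eqxx; apply: (@le_trans _ _ (\sum_(j < m) 2 / m%:R ^+ 2)).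
  by apply: ler_sum => j _; exact: fejer_1Bcos.
rewrite sumr_const card_ord -mulr_natr le_eqVlt; apply/orP; left; apply/eqP.
by field; rewrite pnatr_eq0 -lt0n.
Qed.

(** An argument of Korovkin type: the weights are nonnegative with sum 1, so the error is at most
    the weighted mean of the modulus of [f], whose [1 - cos] terms average to at most [2 / m] per
    coordinate. *)
Lemma fejer_mean_approx m f (e C : R) : (0 < m)%N -> 0 <= C ->
  (forall x y, cabs (f x - f y) <= e + C * \sum_(i < N) (1 - cos (x 0 i - y 0 i))) ->
  forall x, cabs (f x - fejer_mean m f x) <= e + C * (N%:R * (2 / m%:R)).
Proof.
move=> m0 C0 fC x.
have w0 (J : {ffun 'I_N -> 'I_m}) : 0 <= fejer_weight J x.
  by apply: prodr_ge0 => i _; exact: fejer_ge0.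
have -> : f x - fejer_mean m f x =
    \sum_(J : {ffun 'I_N -> 'I_m}) (f x - f (grid_point J)) * (fejer_weight J x)%:C.
  under eq_bigr do rewrite mulrBl; rewrite sumrB; congr (_ - _).
  by rewrite -mulr_sumr -rmorph_sum /= sum_fejer_weight// mulr1.
rewrite -lecR -cabsE; apply: (le_trans (ler_norm_sum _ _ _)).
under eq_bigr do rewrite cabsE cabsM cabs_real (ger0_norm (w0 _)).
rewrite -rmorph_sum lecR.
apply: (@le_trans _ _ (\sum_(J : {ffun 'I_N -> 'I_m})
   (e + C * \sum_(i < N) (1 - cos (x 0 i - grid_point J 0 i))) * fejer_weight J x)).
  by apply: ler_sum => J _; rewrite ler_wpM2r.
under eq_bigr do rewrite mulrDl; rewrite big_split /=; apply: lerD.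
  by rewrite -mulr_sumr sum_fejer_weight// mulr1.
under eq_bigr do rewrite -mulrA mulr_suml; rewrite -mulr_sumr ler_wpM2l//.
rewrite exchange_big /=; apply: (@le_trans _ _ (\sum_(i < N) 2 / m%:R)).
  apply: ler_sum => i _; under eq_bigr do rewrite mulrC.
  exact: sum_fejer_weight_1Bcos.
by rewrite sumr_const card_ord -[leLHS]mulr_natl.
Qed.

Lemma cis_sum (I : finType) (a : I -> R) : cis (\sum_i a i) = \prod_i cis (a i).
Proof. by apply: big_morph; [exact: cisD|exact: cis0]. Qed.

Lemma fejer_mean_character m f : exists (s : seq (R[i] * 'rV[int]_N)),
  fejer_mean m f = fun x => \sum_(ck <- s) ck.1 * character ck.2 x.
Proof.
pose q : R := (m%:R ^+ 2)^-1.
(* One term for each grid point [J] and each choice, in every coordinate, of a pair [(p, q)] from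
   the double sum for the kernel; its frequency there is [p - q]. *)
pose T := ({ffun 'I_N -> 'I_m} * {ffun 'I_N -> 'I_m * 'I_m})%type.
pose c (t : T) : R[i] := f (grid_point t.1) * \prod_(i < N)
  (q%:C * cis (- (((t.2 i).1%:R - (t.2 i).2%:R) * grid_point t.1 0 i))).
pose k (t : T) : 'rV[int]_N := \row_i ((t.2 i).1%:Z - (t.2 i).2%:Z).
exists [seq (c t, k t) | t <- index_enum T]; apply/funext => x.
rewrite big_map /= /fejer_mean.
rewrite -(pair_bigA _ (fun J P => c (J, P) * character (k (J, P)) x)) /=.
apply: eq_bigr => J _; rewrite rmorph_prod /=.
under eq_bigr do rewrite fejerE.
rewrite (bigA_distr_bigA (fun i (p : 'I_m * 'I_m) =>
  q%:C * cis ((p.1%:R - p.2%:R) * (x 0 i - grid_point J 0 i)))) mulr_sumr.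
apply: eq_bigr => P _; rewrite /c /= -mulrA; congr (_ * _).
rewrite /character /dotz cis_sum -big_split; apply: eq_bigr => i _ /=.
have -> : (k (J, P) 0 i)%:~R = (P i).1%:R - (P i).2%:R :> R.
  by rewrite mxE rmorphB /= -!pmulrn.
by rewrite -mulrA -cisD; congr (_ * cis _); ring.
Qed.

End FejerMean.

Section TorusL2.
Context {R : realType} {N : nat} {H : completeNormedModType R[i]}.
Variables (ip : H -> H -> R[i]) (iota : ('rV[R]_N -> R[i]) -> H).
Hypothesis H_L2 : is_torus_L2 ip iota.
Implicit Types f g : 'rV[R]_N -> R[i].

Lemma torus_continuous_lin (a : R[i]) f g :
  torus_continuous f -> torus_continuous g ->
  torus_continuous (fun x => a * f x + g x).
Proof.
move=> [fp rf jf] [gp rg jg]; split.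
- by move=> x k; rewrite fp gp.
- rewrite (_ : re_part _ = fun x => complex.Re a * re_part f x +
    (- complex.Im a * im_part f x + re_part g x)).
    apply: continuous_addf; last apply: continuous_addf => //.
      by apply: continuous_mulf => // x; exact: cst_continuous.
    by apply: continuous_mulf => // x; exact: cst_continuous.
  apply/funext => x; rewrite /re_part /im_part; case: a (f x) (g x) => ? ? [? ?] [? ?] /=.
  by ring.
- rewrite (_ : im_part _ = fun x => complex.Re a * im_part f x +
    (complex.Im a * re_part f x + im_part g x)).
    apply: continuous_addf; last apply: continuous_addf => //.
      by apply: continuous_mulf => // x; exact: cst_continuous.
    by apply: continuous_mulf => // x; exact: cst_continuous.
  apply/funext => x; rewrite /re_part /im_part; case: a (f x) (g x) => ? ? [? ?] [? ?] /=.
  by ring.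
Qed.

Lemma torus_continuous0 : torus_continuous (fun _ : 'rV[R]_N => 0 : R[i]).
Proof. by split => // x; exact: cst_continuous. Qed.

Let iota_lin (a : R[i]) f g : torus_continuous f -> torus_continuous g ->
  iota (fun x => a * f x + g x) = a *: iota f + iota g.
Proof. by case: H_L2 => _ + _ _; exact. Qed.

Lemma iota0 : iota (fun=> 0) = 0.
Proof.
have := iota_lin (-1) torus_continuous0 torus_continuous0.
by rewrite mulr0 addr0 scaleN1r addNr.
Qed.

Lemma iota_trig (s : seq (R[i] * 'rV[int]_N)) :
  torus_continuous (fun x => \sum_(ck <- s) ck.1 * character ck.2 x) /\
  iota (fun x => \sum_(ck <- s) ck.1 * character ck.2 x) =
  \sum_(ck <- s) ck.1 *: iota (character ck.2).
Proof.
elim: s => [|ck s [IHc IHi]].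
  under eq_fun do rewrite big_nil.
  by rewrite big_nil iota0; split => //; exact: torus_continuous0.
under eq_fun do rewrite big_cons.
have ? := character_torus_continuous (R := R) ck.2.
by rewrite big_cons iota_lin// IHi; split => //; exact: torus_continuous_lin.
Qed.

Lemma rnorm_iota_le f (M : R) : torus_continuous f -> (forall x, cabs (f x) <= M) ->
  rnorm (iota f) ^+ 2 <= (2 * pi) ^+ N * M ^+ 2.
Proof.
move=> fc fM; have [ipP _ ipi _] := H_L2.
have -> : rnorm (iota f) ^+ 2 = cube_integral (re_part (fun x => f x * conjc (f x))).
  apply/complexI; rewrite -(ip_rnorm ipP) ipi//; congr (_ +i* _).
  rewrite (_ : im_part _ = fun=> 0).
    have := @cube_integral_le_bound R N (fun=> 0) 0.
    by rewrite mulr0 lexx => /(_ (fun=> isT)) /le_anti.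
  by apply/funext => x; rewrite /im_part -sqr_cabs.
have bnd x : 0 <= re_part (fun x => f x * conjc (f x)) x <= M ^+ 2.
  rewrite /re_part -sqr_cabs /= sqr_ge0 /=.
  by rewrite ler_sqr ?nnegrE ?cabs_ge0// (le_trans _ (fM x)) ?cabs_ge0.
by have /andP[] := cube_integral_le_bound bnd.
Qed.

Lemma characters_total (D : set H) : closed D -> D 0 ->
  (forall a x y, D x -> D y -> D (a *: x + y)) ->
  (forall k, D (iota (character k))) -> forall x, D x.
Proof.
move=> cD D0 DD Dc x; have [ipP _ _ dense_iota] := H_L2.
apply: rnorm_closed_mem => // e e0.
have [_ [f fc <-] xf] := rnorm_dense x dense_iota (divr_gt0 e0 (ltr0n R 2)).
pose V : R := (2 * pi) ^+ N; have V0 : 0 < V by rewrite exprn_gt0// pi2_gt0.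
(* [V] is the volume of the torus: a uniform error [eta] costs at most [eta sqrt V = e / 4] in norm.
   Half of [eta] goes to the constant term of the modulus, half to its averaged cosine terms. *)
pose eta := e / 4 / Num.sqrt V.
have sV : 0 < Num.sqrt V by rewrite sqrtr_gt0.
have eta0 : 0 < eta by rewrite !divr_gt0.
have eta20 : 0 < eta / 2 by rewrite divr_gt0.
have [C C0 fC] := torus_modulus fc eta20.
have [n Cn] := small_rational (C * (N%:R * 2)) eta20.
have apx := fejer_mean_approx (ltn0Sn n) C0 fC.
have [s sE] := fejer_mean_character n.+1 f.
have [gc gi] := iota_trig s.
have Dg : D (iota (fejer_mean n.+1 f)).
  rewrite sE gi; elim: {sE gc gi} s => [|ck s IH]; first by rewrite big_nil.
  by rewrite big_cons; exact: DD.
exists (iota (fejer_mean n.+1 f)) => //.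
apply: (le_lt_trans (rnorm_distD (iota f) _ _)); rewrite (splitr e) ltrD//.
have -> : iota f - iota (fejer_mean n.+1 f) =
    iota (fun x => (-1) * fejer_mean n.+1 f x + f x).
  by rewrite iota_lin// ?sE// scaleN1r addrC.
apply: (@le_lt_trans _ _ (e / 4)); last by lra.
rewrite -ler_sqr ?nnegrE ?rnorm_ge0//; last by lra.
have -> : (e / 4) ^+ 2 = V * eta ^+ 2.
  rewrite -{1}(sqr_sqrtr (ltW V0)) -exprMn /eta (mulrC (Num.sqrt V)) divfK//.
  by rewrite gt_eqF.
apply: rnorm_iota_le => [|y]; first by apply: torus_continuous_lin => //; rewrite sE.
rewrite mulN1r addrC (le_trans (apx y))// [leRHS]splitr lerD2l ltW//.
by move: Cn; rewrite !mulrA.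
Qed.

End TorusL2.

(** * Heat coefficients *)

Lemma heat_coefficients_eq {R : realType} (N : nat) (h1 h2 : R -> R[i]) a :
  (forall t, 0 < t -> h1 t = h2 t) ->
  heat_coefficients N h1 a -> heat_coefficients N h2 a.
Proof.
move=> h12 ha n; apply: cvg_trans (ha n); apply: near_eq_cvg.
by apply/near_right0P; exists 1 => // t t0 _; rewrite h12.
Qed.

(** If the coefficients below [n] agree, the remainders at order [n] differ by exactly
    [(4 pi)^(-N/2) (a n - b n) t^((n-N)/2)]. Both are [o(t^((n-N)/2))], so [a n = b n]. *)
Lemma heat_coefficients_unique {R : realType} (N : nat) (h : R -> R[i]) a b :
  heat_coefficients N h a -> heat_coefficients N h b -> forall k, a k = b k.
Proof.
move=> ha hb; elim/ltn_ind => n IH.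
pose c : R := (4 * pi) `^ (- (N%:R / 2)) * cabs (a n - b n).
have c4 : 0 < (4 * pi) `^ (- (N%:R / 2)) :> R by rewrite powR_gt0// mulr_gt0// pi_gt0.
have c0 : 0 <= c by rewrite mulr_ge0 ?cabs_ge0// ltW.
suff : c <= 0.
  rewrite /c pmulr_rle0// => ab; apply/eqP; rewrite -subr_eq0 -normr_eq0 cabsE.
  by rewrite (inj_eq (@complexI R) _ 0) eq_le ab cabs_ge0.
apply/ler_addgt0Pl => e e0; rewrite addr0.
have e20 : 0 < e / 2 by rewrite divr_gt0.
have /cvgrPdist_lt/(_ _ e20)/near_right0P[d1 d10 dP1] := ha n.
have /cvgrPdist_lt/(_ _ e20)/near_right0P[d2 d20 dP2] := hb n.
pose t := Num.min d1 d2 / 2.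
have t0 : 0 < t by rewrite divr_gt0// lt_min d10.
have t1 : t < d1.
  by rewrite ltr_pdivrMr// (@le_lt_trans _ _ d1) ?ge_min ?lexx//; lra.
have t2 : t < d2.
  by rewrite ltr_pdivrMr// (@le_lt_trans _ _ d2) ?ge_min ?lexx ?orbT//; lra.
have := dP2 t t0 t2; have := dP1 t t0 t1; rewrite !sub0r !normrN.
set P := (_ `^ _)%:C; set Sa := \sum_(k < _) _; set Sb := \sum_(k < _) b _ * _.
set w := t `^ ((n%:R - N%:R) / 2).
have w0 : 0 < w by rewrite powR_gt0.
rewrite !ger0_norm ?divr_ge0 ?cabs_ge0 ?(ltW w0)//.
rewrite !ltr_pdivrMr// => hA hB; rewrite -(ler_pM2r w0).
suff -> : c * w = cabs ((h t - P * Sb) - (h t - P * Sa)).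
  apply: (@le_trans _ _ (cabs (h t - P * Sb) + cabs (h t - P * Sa))).
    by rewrite -lecR rmorphD /= -!cabsE ler_normB.
  by rewrite [e]splitr mulrDl addrC lerD// ltW.
rewrite opprB addrC subrKA -mulrBr /Sa /Sb !big_ord_recr /=.
rewrite (eq_bigr (fun k : 'I_n => b k * (t `^ (k%:R / 2))%:C)); last first.
  by move=> k _; rewrite IH.
rewrite opprD addrACA subrr add0r -mulrBl !cabsM !cabs_real !ger0_norm ?powR_ge0//.
have -> : w = t `^ (- (N%:R / 2)) * t `^ (n%:R / 2).
  by rewrite -powRD ?(gt_eqF t0) ?implybT//; congr (_ `^ _); ring.
by rewrite powRM ?(ltW t0) ?mulr_ge0 ?pi_ge0// /c; ring.
Qed.

(** * Comparison of the two heat traces *)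

Lemma sqnorm_ge0 {R : realType} {N : nat} (k : 'rV[int]_N) : 0 <= sqnorm k :> R.
Proof. by apply: sumr_ge0 => i _; exact: sqr_ge0. Qed.

Lemma torus_semigroup_trace {R : realType} {N : nat} {H : completeNormedModType R[i]}
    (ip : H -> H -> R[i]) (iota : ('rV[R]_N -> R[i]) -> H) (S : R -> H -> H) (t : R) :
  is_torus_L2 ip iota -> torus_heat_semigroup iota S -> 0 < t ->
  trace_class ip (S t) /\
  trace ip (S t) =
    (fine (\esum_(k in [set: 'rV[int]_N]) (expR (- t * sqnorm k))%:E)%E)%:C.
Proof.
move=> H_L2 [CS genS] t0; have [ipP iota_lin ip_iota _] := H_L2.
have cc k := character_torus_continuous (R := R) (N := N) k.
apply: (diagonal_semigroup_trace (u := fun k => iota (character k))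
  (c := (2 * pi) ^+ N) ipP CS) (ltW t0) (esum_gauss_lty N t0).
- by rewrite exprn_gt0// pi2_gt0.
- move=> k l; rewrite ip_iota//.
  under eq_fun do rewrite character_conj.
  by rewrite torus_integral_character subr_eq0.
- exact: characters_total H_L2.
- exact: sqnorm_ge0.
move=> k; rewrite genS; apply: subset_closure; exists (character k).
  exact: character_smooth.
congr pair; rewrite laplacian_character -[RHS]addr0 -(iota0 H_L2) -iota_lin//.
  by congr iota; apply/funext => x; rewrite addr0.
exact: torus_continuous0.
Qed.

(** A unitary cannot vanish since the unit does not. Hence the eigenvalue at [U k], which [nc_trace]
    obtains by choice among all scalars that fit, is unique. *)
Lemma nc_torus_unitary_neq0 {R : realType} {N : nat} (theta : 'M[R]_N)
    (A : cstarAlgType R) (U : 'rV[int]_N -> A) k :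
  torus_relations theta U -> U k != 0.
Proof.
move=> [_ UU _ _]; apply/eqP => U0; have /eqP := @cone_neq0 R A; apply.
rewrite -(UU k) U0; apply: (@linear_map0 _ A A (cmul (cstar 0))) => a x y.
exact: cmul_linearr.
Qed.

Theorem theorem7p6 (R : realType) (N : nat) (theta : 'M[R]_N)
    (theta_antisym : theta^T = - theta)
    (A : cstarAlgType R) (U : 'rV[int]_N -> A)
    (A_torus : is_nc_torus theta U)
    (T : R -> A -> A) (T_heat : nc_heat_semigroup U T)
    (H : completeNormedModType R[i]) (ip : H -> H -> R[i])
    (iota : ('rV[R]_N -> R[i]) -> H) (H_L2 : is_torus_L2 ip iota)
    (S : R -> H -> H) (S_heat : torus_heat_semigroup iota S) :
  (forall t : R, 0 < t ->
    [/\ nc_trace_class U (T t),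
        trace_class ip (S t),
        nc_heat_trace U T t = nc_trace U (T t) &
        nc_trace U (T t) = trace ip (S t)]) /\
  (forall a : nat -> R[i],
    heat_coefficients N (nc_heat_trace U T) a <->
    heat_coefficients N (fun t => trace ip (S t)) a) /\
  (forall a b : nat -> R[i],
    heat_coefficients N (nc_heat_trace U T) a ->
    heat_coefficients N (fun t => trace ip (S t)) b ->
    forall k : nat, a k = b k).
Proof.
have traces (t : R) : 0 < t ->
    [/\ nc_trace_class U (T t), trace_class ip (S t),
        nc_heat_trace U T t = nc_trace U (T t) &
        nc_trace U (T t) = trace ip (S t)].
  move=> t0; have fin := esum_gauss_lty N t0.
  have e0 (k : 'rV[int]_N) : 0 <= expR (- t * sqnorm k) by exact: expR_ge0.
  have [relU _ _] := A_torus; have [_ TU] := T_heat.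
  have [Str ->] := torus_semigroup_trace H_L2 S_heat t0.
  split => //.
    exists (fun k => (expR (- t * sqnorm k))%:C); last by rewrite abs_summable_nonneg.
    by move=> k; rewrite TU// ltW.
  rewrite -csum_nonneg//; congr csum; apply/funext => k.
  apply: xget_unique => [|l] /=; rewrite TU ?(ltW t0)//.
  move=> /eqP; rewrite -subr_eq0 -scalerBl scaler_eq0.
  rewrite (negPf (nc_torus_unitary_neq0 k relU)) orbF subr_eq0 => /eqP -> //.
have eqt t : 0 < t -> nc_heat_trace U T t = trace ip (S t).
  by move=> /traces[_ _ -> ->].
have eqt' t : 0 < t -> trace ip (S t) = nc_heat_trace U T t by move=> /eqt ->.
split=> //; split=> [a|a b /(heat_coefficients_eq eqt)]; last first.
  exact: heat_coefficients_unique.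
by split; apply: heat_coefficients_eq.
Qed.
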